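(* Assume the setting described in the context, with $\acute A$ and $\grave A$ standard preferred sets. Then: (i) every element of $\mathcal{C}^*$ is a finite sum (repetitions allowed) of elements of $\Pi^*=\{\pi_1,\dots,\pi_t\}$, i.e. $\Pi^*$ is a weak spanning set for $\mathcal C^*$; (ii) the ordered set $\vartheta=(\vartheta_1,\dots,\vartheta_t)$, $\vartheta_i=\mathbb T(\pi_i)$, of admissible prime transvectants is a Hilbert basis for $\mathcal J=\ker\mathcal X\subset\mathbb R[[\mathbf x,\mathbf y]]$: each $\vartheta_i$ is a homogeneous weight invariant in $\mathcal J$, and every element of $\mathcal J$ is a (possibly countably infinite, formal) linear combination of the monomials $\vartheta^{\mathbf K}=\vartheta_1^{K_1}\cdots\vartheta_t^{K_t}$, $\mathbf K\in\mathbb N^t$.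
   Context: $\mathbb N=\{0,1,2,\dots\}$. An $\mathfrak{sl}_2$ triad is a triple $(X,Y,Z)$ of linear operators with $[X,Y]=Z$, $[Z,X]=2X$, $[Z,Y]=-2Y$. For a real $n\times n$ matrix $A$ and $f\in\mathbb R[[\mathbf x]]$, $\mathbf x=(x_1,\dots,x_n)$, put $\mathcal D_Af(\mathbf x)=f'(\mathbf x)A\mathbf x$ (gradient row vector times $A\mathbf x$). Let $(\acute X,\acute Y,\acute Z)$ be an $\mathfrak{sl}_2$ triad of real $n\times n$ matrices and $(\grave X,\grave Y,\grave Z)$ one of real $m\times m$ matrices. On $\mathbb R[[\mathbf x]]$ set $\acute{\mathcal X}=\mathcal D_{\acute Y}$, $\acute{\mathcal Y}=\mathcal D_{\acute X}$, $\acute{\mathcal Z}=\mathcal D_{\acute Z}$; on $\mathbb R[[\mathbf y]]$, $\mathbf y=(y_1,\dots,y_m)$, set $\grave{\mathcal X}=\mathcal D_{\grave Y}$, $\grave{\mathcal Y}=\mathcal D_{\grave X}$, $\grave{\mathcal Z}=\mathcal D_{\grave Z}$. These act on $\mathbb R[[\mathbf x,\mathbf y]]$ (acting only on the $\mathbf x$, resp. $\mathbf y$, variables), and $\mathcal X=\acute{\mathcal X}+\grave{\mathcal X}$, $\mathcal Y=\acute{\mathcal Y}+\grave{\mathcal Y}$, $\mathcal Z=\acute{\mathcal Z}+\grave{\mathcal Z}$ (these are $\mathcal D$ of the block-diagonal matrices). Put $\acute{\mathcal J}=\ker\acute{\mathcal X}\subset\mathbb R[[\mathbf x]]$, $\grave{\mathcal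 J}=\ker\grave{\mathcal X}\subset\mathbb R[[\mathbf y]]$, $\mathcal J=\ker\mathcal X\subset\mathbb R[[\mathbf x,\mathbf y]]$. A weight invariant of $\acute{\mathcal J}$ is $f\in\acute{\mathcal J}$ with $\acute{\mathcal Z}f=\widehat f\,f$ for an integer $\widehat f$ (its weight); similarly for $\grave{\mathcal J}$ and $\mathcal J$. A Hilbert basis of $\acute{\mathcal J}$ is a tuple $\alpha=(\alpha_1,\dots,\alpha_p)$ of homogeneous weight invariants (weights $\widehat\alpha_i$) such that every element of $\acute{\mathcal J}$ is a countable linear combination of monomials $\alpha^{\mathbf k}=\alpha_1^{k_1}\cdots\alpha_p^{k_p}$, $\mathbf k\in\mathbb N^p$; write $\widehat\alpha\mathbf k=\sum\widehat\alpha_ik_i$. Similarly $\beta=(\beta_1,\dots,\beta_q)$ is a Hilbert basis of $\grave{\mathcal J}$, $\widehat\beta\boldsymbol\ell=\sum\widehat\beta_j\ell_j$. A preferred set for $\alpha$ is a set $\acute A\subset\mathbb N^p$ such that the polynomials $\alpha^{\mathbf k}$, $\mathbf k\in\acute A$, are pairwise distinct, linearly independent, and every element of $\acute{\mathcal J}$ is a countable linear combination of them; it is standard if $\mathbf k\in\acute A$ and $\mathbf k'\le\mathbf k$ componentwise ($\mathbf k'\in\mathbb N^p$) imply $\mathbf k'\in\acute A$. Let $\acute A$ (for $\alpha$) and $\grave A$ (for $\beta$) be standard preferred sets. External transvectant: for weight invariants $f\in\acute{\mathcal J}$, $g\in\grave{\mathcal J}$ and an integer $s$ with $0\le s\le\widehat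 f$, $0\le s\le\widehat g$, $(f,g)^{(s)}=\sum_{j=0}^s(-1)^j W^{sj}_{fg}(\acute{\mathcal Y}^jf)(\grave{\mathcal Y}^{s-j}g)$, $W^{sj}_{fg}=\binom sj\frac{(\widehat f-j)!}{(\widehat f-s)!}\frac{(\widehat g-s+j)!}{(\widehat g-s)!}$. Transvectant cone: $\mathcal C=\{(\mathbf k;\boldsymbol\ell;s)\in\mathbb N^{p+q+1}: s\le\widehat\alpha\mathbf k,\ s\le\widehat\beta\boldsymbol\ell\}$; transvectant map $\mathbb T(\mathbf k;\boldsymbol\ell;s)=(\alpha^{\mathbf k},\beta^{\boldsymbol\ell})^{(s)}$. $\mathcal C^*=\{(\mathbf k;\boldsymbol\ell;s)\in\mathcal C:\mathbf k\in\acute A,\boldsymbol\ell\in\grave A\}$ (admissible elements). A prime is a nonzero element of $\mathcal C$ that is not a sum of two nonzero elements of $\mathcal C$; the set $\Pi$ of primes is finite. $\Pi^*=\Pi\cap\mathcal C^*=\{\pi_1,\dots,\pi_t\}$ (admissible primes), listed in some fixed order, and $\vartheta_i=\mathbb T(\pi_i)$. *)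

(* Defs.v *)
From HB Require Import structures.
From mathcomp Require Import all_boot all_order all_algebra.
From mathcomp Require Import reals.
Set Implicit Arguments. Unset Strict Implicit. Unset Printing Implicit Defensive.
Import Order.TTheory GRing.Theory Num.Theory.
Local Open Scope ring_scope.

Section Defs.
Variable R : realType.

(** Exponent vectors (monomials) in [n] variables, and formal power series
    R[[x_1..x_n]] represented by their coefficient functions. *)
Definition expo (n : nat) := {ffun 'I_n -> nat}.
Definition ser (n : nat) := expo n -> R.

Definition mdeg n (e : expo n) : nat := (\sum_(i < n) e i)%N.

Definition sone n : ser n := fun e => (e == [ffun=> 0%N])%:R.

Definition smul n (f g : ser n) : ser n := fun e =>
  \sum_(a : {ffun 'I_n -> 'I_(mdeg e).+1} | [forall i, (a i <= e i)%N])
     f [ffun i => nat_of_ord (a i)] * g [ffun i => (e i - a i)%N].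

Definition spow n (f : ser n) (k : nat) : ser n := iter k (smul f) (@sone n).

Definition smon n p (a : 'I_p -> ser n) (k : expo p) : ser n :=
  \big[@smul n/@sone n]_(i < p) spow (a i) (k i).

Definition incr n (i : 'I_n) (e : expo n) : expo n := [ffun k => e k + (k == i)]%N.
Definition decr n (j : 'I_n) (e : expo n) : expo n := [ffun k => e k - (k == j)]%N.

(** D_A f (x) = f'(x) A x = sum_{i,j} A_ij x_j d_i f, coefficientwise. *)
Definition Dop n (A : 'M[R]_n) (f : ser n) : ser n := fun e =>
  \sum_(i < n) \sum_(j < n)
     (if (0 < e j)%N then A i j * ((decr j e) i).+1%:R * f (incr i (decr j e))
      else 0).

Definition sl2_triad n (X Y Z : 'M[R]_n) : Prop :=
  [/\ X *m Y - Y *m X = Z, Z *m X - X *m Z = 2%:R *: X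
    & Z *m Y - Y *m Z = - (2%:R *: Y)].

(** [in_ker MX f]: f lies in ker D_{MX} (MX is the matrix whose D is the
    operator calligraphic X). *)
Definition in_ker n (MX : 'M[R]_n) (f : ser n) : Prop := forall e, Dop MX f e = 0.

Definition weight_inv n (MX MZ : 'M[R]_n) (f : ser n) (w : int) : Prop :=
  in_ker MX f /\ forall e, Dop MZ f e = w%:~R * f e.

Definition homog n (f : ser n) : Prop :=
  exists d : nat, forall e, mdeg e != d -> f e = 0.

(** f is a (countable, formal) linear combination of the family fam indexed
    by the elements k with P k: for each coefficient only finitely many
    terms contribute (summability in the formal topology). *)
Definition formal_comb n (K : eqType) (P : K -> Prop) (fam : K -> ser n)
    (f : ser n) : Prop :=
  exists c : K -> R, (forall k, ~ P k -> c k = 0) /\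
   forall e, exists s : seq K,
     [/\ uniq s, (forall k, k \notin s -> c k * fam k e = 0)
       & f e = \sum_(k <- s) c k * fam k e].

Definition hilbert_basis_w n (MX MZ : 'M[R]_n) p (a : 'I_p -> ser n)
    (w : 'I_p -> int) : Prop :=
  (forall i, homog (a i) /\ weight_inv MX MZ (a i) (w i)) /\
  (forall f, in_ker MX f -> formal_comb (fun _ => True) (smon a) f).

Definition hilbert_basis n (MX MZ : 'M[R]_n) p (a : 'I_p -> ser n) : Prop :=
  exists w, hilbert_basis_w MX MZ a w.

Definition preferred_set n (MX : 'M[R]_n) p (a : 'I_p -> ser n)
    (A : expo p -> Prop) : Prop :=
  [/\ (forall k k', A k -> A k' -> (forall e, smon a k e = smon a k' e) -> k = k'),
      (forall (s : seq (expo p)) (c : expo p -> R), uniq s ->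
          (forall k, k \in s -> A k) ->
          (forall e, \sum_(k <- s) c k * smon a k e = 0) ->
          forall k, k \in s -> c k = 0)
    & (forall f, in_ker MX f -> formal_comb A (smon a) f)].

Definition standard_preferred_set n (MX : 'M[R]_n) p (a : 'I_p -> ser n)
    (A : expo p -> Prop) : Prop :=
  preferred_set MX a A /\
  (forall k k' : expo p, A k -> (forall i, (k' i <= k i)%N) -> A k').

Definition cel p q := (expo p * expo q * nat)%type.
Definition czero p q : cel p q := ([ffun=> 0%N], [ffun=> 0%N], 0%N).
Definition cadd p q (c d : cel p q) : cel p q :=
  ([ffun i => c.1.1 i + d.1.1 i]%N, [ffun j => c.1.2 j + d.1.2 j]%N, (c.2 + d.2)%N).

Definition wdot p (w : 'I_p -> int) (k : expo p) : int := \sum_(i < p) w i * (k i)%:Z.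

Definition in_cone p q (wa : 'I_p -> int) (wb : 'I_q -> int) (c : cel p q) : Prop :=
  ((c.2)%:Z <= wdot wa c.1.1) /\ ((c.2)%:Z <= wdot wb c.1.2).

Definition admissible p q wa wb (Aa : expo p -> Prop) (Ab : expo q -> Prop)
    (c : cel p q) : Prop :=
  [/\ in_cone wa wb c, Aa c.1.1 & Ab c.1.2].

Definition cone_prime p q (wa : 'I_p -> int) (wb : 'I_q -> int) (c : cel p q) : Prop :=
  [/\ in_cone wa wb c, c <> czero p q &
      ~ exists d1 d2, [/\ in_cone wa wb d1, in_cone wa wb d2,
                          d1 <> czero p q, d2 <> czero p q & c = cadd d1 d2]].

Definition admissible_prime p q wa wb Aa Ab (c : cel p q) : Prop :=
  cone_prime wa wb c /\ admissible wa wb Aa Ab c.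

Definition tensor n m (F : ser n) (G : ser m) : ser (n + m) := fun e =>
  F [ffun i => e (lshift m i)] * G [ffun j => e (rshift n j)].

Definition Wcoef (a b s j : nat) : R :=
  'C(s, j)%:R * ((a - j)`!%:R / (a - s)`!%:R) * ((b - s + j)`!%:R / (b - s)`!%:R).

(** External transvectant (f,g)^(s), f of weight a, g of weight b;
    MYa, MYg are the matrices whose D is the operator calligraphic Y
    (i.e. the matrices X-acute, X-grave). *)
Definition transv n m (MYa : 'M[R]_n) (MYg : 'M[R]_m) (a b : nat)
    (f : ser n) (g : ser m) (s : nat) : ser (n + m) := fun e =>
  \sum_(j < s.+1) (-1) ^+ j * Wcoef a b s j *
      tensor (iter j (Dop MYa) f) (iter (s - j) (Dop MYg) g) e.

Definition Tmap n m (MYa : 'M[R]_n) (MYg : 'M[R]_m) p q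
    (alpha : 'I_p -> ser n) (wa : 'I_p -> int)
    (beta : 'I_q -> ser m) (wb : 'I_q -> int) (c : cel p q) : ser (n + m) :=
  transv MYa MYg `|wdot wa c.1.1|%N `|wdot wb c.1.2|%N
         (smon alpha c.1.1) (smon beta c.1.2) c.2.

End Defs.

(* Main.v *)
Require Import Defs.
From HB Require Import structures.
From mathcomp Require Import all_boot all_order all_algebra.
From mathcomp Require Import reals boolp.
From mathcomp Require Import ring zify mpoly.
Import Order.TTheory GRing.Theory Num.Theory.
Local Open Scope ring_scope.
Set Implicit Arguments. Unset Strict Implicit. Unset Printing Implicit Defensive.

(** Write [X = X1 + X2], where [X1], [X2] are the parts of the operator acting
    on the x- and on the y-variables.  On a transvectant [(f,g)^(s)] the
    power [X1^s] takes a nonzero multiple of [f g] as value and [X1^(s+1)]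
    vanishes.  By the Leibniz rule the same holds for a product of
    transvectants: if the exponents and orders of the factors add up to
    [(k;l;s)], then [X1^s] sends the product to a nonzero multiple of
    [alpha^k beta^l], and [X1^(s+1)] kills it.

    Let [h] in [ker X] be homogeneous with [X1^(r+1) h = 0].  Then [X1^r h] lies in
    [ker X1] and in [ker X2], hence is a combination of the [alpha^k beta^l] with
    [k] and [l] in the preferred sets.  As [X1^r h] is in the image of [X1^r] and,
    up to sign, of [X2^r], sl2-theory forces [r <= wt alpha^k] and
    [r <= wt beta^l] in every term.  So [(k;l;r)] is admissible, hence a sum of
    admissible primes, and subtracting multiples of the corresponding
    products of prime transvectants kills [X1^r h].  Induct on [r]. *)

(** * Representations of sl2 and derivations *)

Section IterLinear.
Variables (F : numFieldType) (V : lmodType F) (L : {linear V -> V}).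

Lemma iter_linear0 k : iter k L 0 = 0.
Proof. by rewrite iter_fix ?linear0. Qed.

Lemma iter_linearD k f g : iter k L (f + g) = iter k L f + iter k L g.
Proof. by elim: k => // k IH; rewrite !iterS IH linearD. Qed.

Lemma iter_linearZ k a f : iter k L (a *: f) = a *: iter k L f.
Proof. by elim: k => // k IH; rewrite !iterS IH linearZ. Qed.

Lemma iter_linear_sum k (I : Type) (r : seq I) (c : I -> V) :
  iter k L (\sum_(i <- r) c i) = \sum_(i <- r) iter k L (c i).
Proof. by elim/big_rec2: _ => [|i x y _ <-]; rewrite ?iter_linear0 ?iter_linearD. Qed.

End IterLinear.

Section Sl2Module.
Variables (F : numFieldType) (V : lmodType F) (X Y Z : {linear V -> V}).
Hypothesis XY : forall v, X (Y v) = Y (X v) + Z v.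
Hypothesis ZX : forall v, Z (X v) = X (Z v) + 2%:R *: X v.
Hypothesis ZY : forall v, Z (Y v) = Y (Z v) - 2%:R *: Y v.

(** Carrying [Y] through each of the [k+1] factors [X] leaves a [Z]. Moving these [Z] to the front
    costs [2 + 4 + ... + 2k = k (k+1)] copies of [X^k v]. *)
Lemma iterX_Y k v : iter k.+1 X (Y v) =
  Y (iter k.+1 X v) + k.+1%:R *: (Z (iter k X v) - k%:R *: iter k X v).
Proof.
elim: k => [|k IH]; first by rewrite /= XY scale0r subr0 scale1r.
rewrite iterS IH linearD linearZ_LR linearB linearZ_LR XY.
have -> : X (Z (iter k X v)) = Z (iter k.+1 X v) - 2%:R *: iter k.+1 X v.
  by rewrite [iter k.+1 _ _]/= ZX addrK.
rewrite -[X (iter k X v)]/(iter k.+1 X v) -[X (iter k.+1 X v)]/(iter k.+2 X v).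
rewrite -addrA; congr (_ + _); move: (iter k.+1 X v) => b.
rewrite -addrA -opprD -scalerDl !scalerBr !scalerA addrA -{1}[Z b]scale1r -scalerDl.
by congr (_ *: _ - _ *: _); rewrite !mulrS; ring.
Qed.

(* Applying [Y] raises [s] by one and multiplies the top vector
   [X^s v] by [(s+1) * (Z - s)]; after [N] steps nothing is left. *)
Lemma top_vector_relation N (I : Type) (r : seq I) (f : I -> V) (w : I -> F) :
  (forall i, Z (f i) = w i *: f i) ->
  forall s v (c : I -> F), iter N Y v = 0 -> iter s.+1 X v = 0 ->
  iter s X v = \sum_(i <- r) c i *: f i ->
  \sum_(i <- r) (c i * \prod_(j < N) (w i - (s + j)%:R)) *: f i = 0.
Proof.
move=> Zf; elim: N => [|N IH] s v c.
  move=> /= -> _; rewrite iter_fix ?linear0 // => /esym E.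
  by rewrite -[RHS]E; apply: eq_bigr => i _; rewrite big_ord0 mulr1.
rewrite iterSr => Yv Xv Fv.
have Xv2 : iter s.+2 X (Y v) = 0.
  by rewrite iterX_Y (iterS s.+1) Xv !(linear0, addr0).
(* The induction passes to [Y v]: by [iterX_Y], its image under [X^(s+1)] is the old top vector with
   these new coefficients. *)
have := IH s.+1 (Y v) (fun i => s.+1%:R * (w i - s%:R) * c i) Yv Xv2.
rewrite iterX_Y Xv linear0 add0r Fv linear_sum scaler_sumr -sumrB scaler_sumr.
have E i : s.+1%:R *: (Z (c i *: f i) - s%:R *: (c i *: f i)) =
    (s.+1%:R * (w i - s%:R) * c i) *: f i.
  by rewrite linearZ /= Zf !scalerA -scalerBl scalerA -mulrA; congr (_ *: _); ring.
rewrite (eq_bigr _ (fun i _ => E i)) => /(_ erefl) H.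
apply: (@scalerI _ _ s.+1%:R); first by rewrite pnatr_eq0.
rewrite scaler0 -[RHS]H scaler_sumr; apply: eq_bigr => i _.
rewrite scalerA big_ord_recl addn0; congr (_ *: _).
rewrite !mulrA; congr (_ * _); first by ring.
by apply: eq_bigr => j _; rewrite lift0 addSnnS.
Qed.

Variables (f : V) (w : F).
Hypotheses (Xf : X f = 0) (Zf : Z f = w *: f).

Lemma weight_iterY j : Z (iter j Y f) = (w - j.*2%:R) *: iter j Y f.
Proof.
elim: j => [|j IH]; first by rewrite subr0.
rewrite iterS ZY IH linearZ -scalerBl; congr (_ *: _).
by rewrite doubleS -[_.+2]addn2 natrD; ring.
Qed.

Lemma X_iterY j : X (iter j.+1 Y f) = (j.+1%:R * (w - j%:R)) *: iter j Y f.
Proof.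
elim: j => [|j IH]; first by rewrite /= XY Xf linear0 add0r Zf subr0 mul1r.
rewrite iterS XY IH linearZ weight_iterY -scalerDl; congr (_ *: _).
by rewrite -addnn natrD !mulrS; ring.
Qed.

Lemma iterX_iterY_lt s j : (j < s)%N -> iter s X (iter j Y f) = 0.
Proof.
elim: s j => [|s IH] [|j] // js.
  by rewrite iterSr [iter 0 _ _]/= Xf iter_fix ?linear0.
rewrite iterSr X_iterY.
by rewrite iter_linearZ IH ?scaler0.
Qed.

(** Each [X] undoes one [Y] at the cost of a factor from [X_iterY]. For a natural number [w >= s] no
    factor vanishes, which later makes the top value of a transvectant nonzero. *)
Lemma iterX_iterY s : iter s X (iter s Y f) = (\prod_(i < s) (i.+1%:R * (w - i%:R))) *: f.
Proof.
elim: s => [|s IH]; first by rewrite big_ord0 scale1r.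
rewrite iterSr X_iterY.
by rewrite iter_linearZ IH scalerA big_ord_recr /= mulrC.
Qed.

End Sl2Module.

(** * Derivations of a commutative algebra *)

Section Derivation.
Variables (F : numFieldType) (P : comAlgType F) (D : {linear P -> P}).
Hypothesis Leibniz : forall f g, D (f * g) = D f * g + f * D g.

Lemma derivation1 : D 1 = 0.
Proof.
have := Leibniz 1 1; rewrite !mulr1 mul1r => /eqP.
by rewrite -subr_eq0 opprD addNKr oppr_eq0 => /eqP.
Qed.

(** Every term [D^i f * D^j g] of the Leibniz expansion has [i + j = a + b - 1], so [i >= a] or
    [j >= b]. *)
Lemma iter_derivation_eq0 a b f g : iter a D f = 0 -> iter b D g = 0 ->
  iter (a + b).-1 D (f * g) = 0.
Proof.
move En: (a + b)%N => n; elim: n a b f g En => [|n IH] a b f g En fa gb.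
  by case: a b En fa gb => [|a] [|b] //= _ ->; rewrite mul0r.
case: a En fa => [|a] En fa.
  by rewrite [f]fa mul0r iter_linear0.
case: b En gb => [|b] En gb.
  by rewrite [g]gb mulr0 iter_linear0.
have ? : n = (a + b).+1 by lia. subst n.
rewrite [_.-1]/= iterSr Leibniz iter_linearD.
have -> : iter (a + b) D (D f * g) = 0.
  by apply: (IH a b.+1); rewrite ?addnS // -iterSr.
by rewrite add0r; apply: (IH a.+1 b); rewrite ?addnS // -iterSr.
Qed.

(** All other terms of the Leibniz expansion vanish. The factor is a binomial coefficient, of which
    only positivity matters. *)
Lemma iter_derivation_top a b f g : iter a.+1 D f = 0 -> iter b.+1 D g = 0 ->
  exists2 k : nat, (0 < k)%N & iter (a + b) D (f * g) = k%:R *: (iter a D f * iter b D g).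
Proof.
move En: (a + b)%N => n; elim: n a b f g En => [|n IH] a b f g En fa gb.
  by exists 1%N => //; case: a b En {fa gb} => [|a] [|b] //= _; rewrite scale1r.
rewrite iterSr Leibniz iter_linearD.
(* For [a = 0] this summand vanishes and its factor is 0, and likewise the other one for [b = 0].
   Since [a + b > 0], the two factors have a positive sum. *)
have L : exists2 k : nat, ((0 < a) ==> (0 < k))%N &
    iter n D (D f * g) = k%:R *: (iter a D f * iter b D g).
  case: a En fa => [|a] En fa.
    by exists 0%N => //; rewrite [D f]fa mul0r iter_linear0 scale0r.
  rewrite iterSr; rewrite iterSr in fa.
  by have [|k k0 ->] := IH a b (D f) g _ fa gb; [lia | exists k].
have R : exists2 k : nat, ((0 < b) ==> (0 < k))%N &
    iter n D (f * D g) = k%:R *: (iter a D f * iter b D g).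
  case: b En gb {L} => [|b] En gb.
    by exists 0%N => //; rewrite [D g]gb mulr0 iter_linear0 scale0r.
  rewrite [iter b.+1 D g]iterSr; rewrite iterSr in gb.
  by have [|k k0 ->] := IH a b f (D g) _ fa gb; [lia | exists k].
case: L R => [k1 p1 ->] [k2 p2 ->].
by exists (k1 + k2)%N; [lia | rewrite natrD scalerDl].
Qed.

Lemma derivation_eigenM f g (a b : F) : D f = a *: f -> D g = b *: g ->
  D (f * g) = (a + b) *: (f * g).
Proof. by move=> Df Dg; rewrite Leibniz Df Dg -scalerAl -scalerAr scalerDl. Qed.

Lemma derivation_eigen_exp p (u : 'I_p -> P) (w : 'I_p -> int) (k : expo p) :
  (forall i, D (u i) = (w i)%:~R *: u i) ->
  D (\prod_i u i ^+ k i) = (wdot w k)%:~R *: \prod_i u i ^+ k i.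
Proof.
move=> Du; rewrite /wdot rmorph_sum /=.
elim/big_rec2: _ => [|i x y _ IH]; first by rewrite derivation1 scale0r.
apply: derivation_eigenM => //.
elim: (k i) => [|j IHj]; first by rewrite expr0 derivation1 mulr0 scale0r.
rewrite exprS (derivation_eigenM (Du i) IHj); congr (_ *: _).
by rewrite -intrD; congr (_%:~R); rewrite -addn1 PoszD; ring.
Qed.

End Derivation.

(** * Transvectants in a commutative algebra *)

Section Transvectant.
Variable R : realType.

(** This ratio of consecutive coefficients balances the factors that [X_iterY] produces for [f] and
    for [g], so that neighbouring terms of a transvectant cancel under [X1 + X2]. *)
Lemma Wcoef_recl a b s j : (j < s)%N -> (s <= a)%N -> (s <= b)%N ->
  Wcoef R a b s j.+1 * (j.+1%:R * (a%:R - j%:R)) =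
  Wcoef R a b s j * ((s - j)%:R * (b%:R - (s - j.+1)%:R)).
Proof.
move=> js sa sb; rewrite /Wcoef.
have -> : (a%:R - j%:R : R) = (a - j)%:R by rewrite natrB //; lia.
have -> : (b%:R - (s - j.+1)%:R : R) = (b - s + j).+1%:R.
  by rewrite -natrB; [congr (_%:R); lia | lia].
have E1 : (j.+1%:R * 'C(s, j.+1)%:R : R) = (s - j)%:R * 'C(s, j)%:R.
  by rewrite -!natrM mul_bin_left.
have E2 : (a - j)`!%:R = (a - j)%:R * (a - j.+1)`!%:R :> R.
  have -> : (a - j)%N = (a - j.+1).+1 by lia.
  by rewrite factS natrM.
rewrite addnS factS natrM E2.
transitivity ((j.+1%:R * 'C(s, j.+1)%:R) * ((a - j.+1)`!%:R / (a - s)`!%:R) *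
   ((b - s + j).+1%:R * (b - s + j)`!%:R / (b - s)`!%:R) * (a - j)%:R : R).
  by ring.
by rewrite E1; ring.
Qed.

Variables (P : comAlgType R) (X1 Y1 Z1 X2 Y2 Z2 : {linear P -> P}).
Hypothesis LX1 : forall f g, X1 (f * g) = X1 f * g + f * X1 g.
Hypothesis LX2 : forall f g, X2 (f * g) = X2 f * g + f * X2 g.
Hypothesis LZ1 : forall f g, Z1 (f * g) = Z1 f * g + f * Z1 g.
Hypothesis LZ2 : forall f g, Z2 (f * g) = Z2 f * g + f * Z2 g.
Hypothesis XY1 : forall v, X1 (Y1 v) = Y1 (X1 v) + Z1 v.
Hypothesis ZY1 : forall v, Z1 (Y1 v) = Y1 (Z1 v) - 2%:R *: Y1 v.
Hypothesis XY2 : forall v, X2 (Y2 v) = Y2 (X2 v) + Z2 v.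
Hypothesis ZY2 : forall v, Z2 (Y2 v) = Y2 (Z2 v) - 2%:R *: Y2 v.

Variables (f g : P) (a b s : nat).
Hypotheses (X1f : X1 f = 0) (Z1f : Z1 f = a%:R *: f).
Hypotheses (X2g : X2 g = 0) (Z2g : Z2 g = b%:R *: g).
Hypotheses (X1g : forall j, X1 (iter j Y2 g) = 0) (X2f : forall j, X2 (iter j Y1 f) = 0).
Hypotheses (Z1g : forall j, Z1 (iter j Y2 g) = 0) (Z2f : forall j, Z2 (iter j Y1 f) = 0).
Hypotheses (sa : (s <= a)%N) (sb : (s <= b)%N).

(** Both arguments live in one algebra [P], so that the tensor product in [transv] becomes an
    ordinary product to which the Leibniz rule applies. *)
Definition ptransv : P :=
  \sum_(j < s.+1) ((-1) ^+ j * Wcoef R a b s j) *: (iter j Y1 f * iter (s - j) Y2 g).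

Lemma ptransv_ker : X1 ptransv + X2 ptransv = 0.
Proof.
(* [X1] kills the term [j = 0] and [X2] kills the term [j = s]. Without them, term [j+1] of the
   first sum faces term [j] of the second and cancels it by [Wcoef_recl], the signs being
   opposite. *)
rewrite /ptransv !linear_sum big_ord_recl [X in _ + X]big_ord_recr /=.
rewrite [X1 _]linearZ /= LX1 X1f mul0r X1g mulr0 addr0 scaler0 add0r.
rewrite subnn [X in _ + (_ + X)]linearZ /= LX2 X2g mulr0 X2f mul0r addr0 scaler0 addr0.
rewrite -big_split big1 // => j _ /=; rewrite !linearZ /= LX1 LX2.
rewrite X1g X2f mulr0 mul0r addr0 add0r.
have js := ltn_ord j.
have -> : (s - j)%N = (s - j.+1).+1 by lia.
rewrite /bump leq0n !add1n add0n -[Y1 _]/(iter j.+1 Y1 f).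
rewrite (X_iterY XY1 ZY1 X1f Z1f) (X_iterY XY2 ZY2 X2g Z2g).
rewrite -scalerAl -scalerAr !scalerA -scalerDl.
apply/eqP; rewrite scaler_eq0; apply/orP; left; apply/eqP.
rewrite -mulrA (Wcoef_recl js sa sb) exprS.
have -> : (s - j)%N = (s - j.+1).+1 by lia.
by ring.
Qed.

Lemma ptransv_weight :
  Z1 ptransv + Z2 ptransv = (a%:R + b%:R - s.*2%:R) *: ptransv.
Proof.
rewrite /ptransv !linear_sum -big_split; apply: eq_bigr => j _ /=.
rewrite !linearZ /= LZ1 LZ2 Z1g Z2f mulr0 mul0r addr0 add0r.
rewrite (weight_iterY ZY1 Z1f) (weight_iterY ZY2 Z2g).
rewrite -scalerAl -scalerAr !scalerA -scalerDl; congr (_ *: _).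
have js := ltn_ord j.
have -> : s.*2%:R = j.*2%:R + (s - j).*2%:R :> R by rewrite -natrD; congr (_%:R); lia.
by ring.
Qed.

Lemma iter_derivation_constr k u j : iter k X1 (u * iter j Y2 g) = iter k X1 u * iter j Y2 g.
Proof. by elim: k => // k IH; rewrite !iterS IH LX1 X1g mulr0 addr0. Qed.

(** The iterates of [Y2] on [g] are constants for [X1], and [X1^s] kills [Y1^j f] for [j < s]; only
    the term [j = s] survives. Its factor is nonzero because [s <= a]. *)
Lemma ptransv_top : exists2 k : R, k != 0 & iter s X1 ptransv = k *: (f * g).
Proof.
exists ((-1) ^+ s * Wcoef R a b s s * \prod_(i < s) (i.+1%:R * (a%:R - i%:R))).
  rewrite mulf_neq0 //; last first.
    rewrite prodf_seq_neq0; apply/allP => i _ /=; have := ltn_ord i => ltis.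
    by rewrite mulf_neq0 ?pnatr_eq0 // -natrB ?pnatr_eq0; lia.
  rewrite mulf_neq0 ?signr_eq0 // /Wcoef binn mul1r.
  by rewrite !mulf_neq0 ?invr_eq0 ?pnatr_eq0 -?lt0n ?fact_gt0.
rewrite /ptransv iter_linear_sum big_ord_recr big1 /= => [|j _].
  rewrite add0r iter_linearZ subnn (iter_derivation_constr _ _ 0).
  by rewrite (iterX_iterY XY1 ZY1 X1f Z1f) -scalerAl scalerA.
rewrite iter_linearZ iter_derivation_constr.
by rewrite (iterX_iterY_lt XY1 ZY1 X1f Z1f) ?ltn_ord // mul0r scaler0.
Qed.

Lemma iterS_ptransv : iter s.+1 X1 ptransv = 0.
Proof.
by have [k _] := ptransv_top; rewrite iterS => ->; rewrite linearZ /= LX1 X1f (X1g 0) mulr0 mul0r addr0 scaler0.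
Qed.

End Transvectant.

(** * Power series and polynomials *)

Section Bridge.
Variables (R : realType) (n : nat).
Implicit Types (p q : {mpoly R[n]}) (e : expo n).

Definition mnm_of_expo e : 'X_{1..n} := [multinom e i | i < n].
Definition expo_of_mnm (m : 'X_{1..n}) : expo n := [ffun i => m i].
(** Homogeneous series are polynomials, so the algebra is done in the ring [{mpoly R[n]}] and
    carried back along this injection. *)
Definition pser p : ser R n := fun e => p@_(mnm_of_expo e).

Lemma mnm_of_expoK : cancel mnm_of_expo expo_of_mnm.
Proof. by move=> e; apply/ffunP=> i; rewrite ffunE mnmE. Qed.

Lemma expo_of_mnmK : cancel expo_of_mnm mnm_of_expo.
Proof. by move=> m; apply/mnmP=> i; rewrite mnmE ffunE. Qed.

Lemma mdeg_mnm_of_expo e : mpoly.mdeg (mnm_of_expo e) = Defs.mdeg e.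
Proof. by rewrite mdegE /Defs.mdeg; apply: eq_bigr => i _; rewrite mnmE. Qed.

Lemma pser_inj p q : (forall e, pser p e = pser q e) -> p = q.
Proof. by move=> pq; apply/mpolyP => m; have := pq (expo_of_mnm m); rewrite /pser expo_of_mnmK. Qed.

Lemma pserM p q : pser (p * q) = smul (pser p) (pser q).
Proof.
apply/funext => e; rewrite /smul /pser.
have lt_e : (mpoly.mdeg (mnm_of_expo e) < (Defs.mdeg e).+1)%N by rewrite mdeg_mnm_of_expo.
rewrite [LHS](mcoeff_poly_mul_lin p q lt_e).
have lt0 : (mpoly.mdeg (0%MM : 'X_{1..n}) < (Defs.mdeg e).+1)%N by rewrite mdeg0.
(* The two products are sums over different finite types, bounded multinomials and bounded
   functions. [h] and [h'] translate between them; a function below [e] has degree at most that of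
   [e], so the default in [h'] is not reached for it. *)
pose h (m : 'X_{1..n < (Defs.mdeg e).+1}) : {ffun 'I_n -> 'I_(Defs.mdeg e).+1} :=
  [ffun i => inord (m i)].
pose h' (a : {ffun 'I_n -> 'I_(Defs.mdeg e).+1}) : 'X_{1..n < (Defs.mdeg e).+1} :=
  insubd (BMultinom lt0) [multinom (a i : nat) | i < n].
have le_mdeg (m : 'X_{1..n}) i : (m i <= mpoly.mdeg m)%N.
  by rewrite mdegE (bigD1 i) //= leq_addr.
have hE m i : h m i = m i :> nat.
  by rewrite ffunE inordK // (leq_ltn_trans (le_mdeg _ _)) // bmdeg.
have h'K m : h' (h m) = m.
  apply: val_inj; rewrite /h' val_insubd.
  have -> : [multinom (h m i : nat) | i < n] = m :> 'X_{1..n}.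
    by apply/mnmP => i; rewrite mnmE hE.
  by rewrite bmdeg.
rewrite [RHS](reindex_onto h h') /=.
  apply: eq_big => [m|m _].
    rewrite h'K eqxx andbT; apply/mnm_lepP/forallP => H i; have := H i;
    by rewrite hE mnmE.
  by congr (_ * _); [congr (mcoeff _ p)|congr (mcoeff _ q)]; apply/mnmP => i; rewrite ?mnmBE !mnmE ffunE hE.
move=> a /forallP le_ae; apply/ffunP => i; apply: val_inj; rewrite [LHS]hE /h' val_insubd.
rewrite ifT ?mnmE //= mdegE ltnS /Defs.mdeg; apply: leq_sum => j _.
by rewrite mnmE.
Qed.

Lemma pser1 : pser 1 = @sone R n.
Proof.
apply/funext => e; rewrite /pser mcoeff1 /sone; congr (_%:R).
congr nat_of_bool; apply/eqP/eqP => [/mnmP E|->].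
  by apply/ffunP => i; have := E i; rewrite mnmE mnm0E ffunE.
by apply/mnmP => i; rewrite mnmE mnm0E ffunE.
Qed.

Lemma pserX p k : pser (p ^+ k) = spow (pser p) k.
Proof. by elim: k => [|k IH]; rewrite ?expr0 ?pser1 // exprS pserM IH. Qed.

Lemma pser_smon r (a : 'I_r -> {mpoly R[n]}) (k : expo r) :
  pser (\prod_i a i ^+ k i) = smon (fun i => pser (a i)) k.
Proof.
rewrite /smon (big_morph _ pserM pser1); apply: eq_bigr => i _; exact: pserX.
Qed.

Lemma pserZ c p e : pser (c *: p) e = c * pser p e.
Proof. exact: mcoeffZ. Qed.

Lemma pserD p q e : pser (p + q) e = pser p e + pser q e.
Proof. exact: mcoeffD. Qed.

Lemma pser_sum (I : Type) (r : seq I) (P : pred I) (f : I -> {mpoly R[n]}) e :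
  pser (\sum_(i <- r | P i) f i) e = \sum_(i <- r | P i) pser (f i) e.
Proof. by rewrite /pser raddf_sum. Qed.

Definition Dm (A : 'M[R]_n) p : {mpoly R[n]} :=
  \sum_(i < n) \sum_(j < n) A i j *: ('X_j * p^`M(i)).

Lemma mcoeffXUM j q m : ('X_j * q)@_m = if (0 < m j)%N then q@_(m - U_(j)) else 0.
Proof.
case: ifP => mj.
  have {1}-> : m = (U_(j) + (m - U_(j)))%MM.
    rewrite addmC submK //; apply/mnm_lepP => i; rewrite mnm1E.
    by case: eqP => // <-.
  by rewrite mulrC mcoeffMX.
apply/eqP; rewrite mcoeff_eq0 mulrC (perm_mem (msuppMX _ _)).
by apply/mapP => -[m' _ E]; move: mj; rewrite E mnmDE mnm1E eqxx.
Qed.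

Lemma pser_Dm A p : pser (Dm A p) = Dop A (pser p).
Proof.
apply/funext => e; rewrite /Dm /Dop pser_sum; apply: eq_bigr => i _.
rewrite pser_sum; apply: eq_bigr => j _; rewrite pserZ /pser mcoeffXUM mnmE.
case: ifP => ej; last by rewrite mulr0.
rewrite mcoeff_deriv -mulrA mulr_natl.
have -> : (mnm_of_expo e - U_(j) + U_(i))%MM = mnm_of_expo (incr i (decr j e)).
  by apply/mnmP => k; rewrite mnmDE mnmBE !mnmE ?mnm1E !ffunE ![k == _]eq_sym.
by rewrite mnmBE mnmE mnm1E /decr ffunE [in RHS]eq_sym.
Qed.

Fact Dm_is_linear A : linear (Dm A).
Proof.
move=> c p q; rewrite /Dm scaler_sumr -big_split; apply: eq_bigr => i _ /=.
rewrite scaler_sumr -big_split; apply: eq_bigr => j _ /=.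
by rewrite linearP mulrDr scalerDr -scalerAr !scalerA mulrC.
Qed.
HB.instance Definition _ A := GRing.isLinear.Build R _ _ _ (Dm A) (Dm_is_linear A).

Lemma DmM A p q : Dm A (p * q) = Dm A p * q + p * Dm A q.
Proof.
rewrite /Dm mulr_suml mulr_sumr -big_split; apply: eq_bigr => i _ /=.
rewrite mulr_suml mulr_sumr -big_split; apply: eq_bigr => j _ /=.
rewrite mderivM -scalerAl -scalerAr -scalerDr; congr (_ *: _); ring.
Qed.

Lemma Dm_X A i : Dm A 'X_i = \sum_j A i j *: 'X_j.
Proof.
rewrite /Dm (bigD1 i) //= [X in _ + X]big1 ?addr0 => [|k ki].
  apply: eq_bigr => j _; rewrite mderivX mnm1E eqxx scale1r.
  have -> : (U_(i) - U_(i) = 0 :> 'X_{1..n})%MM by apply/mnmP => k; rewrite mnmBE mnm0E subnn.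
  by rewrite mpolyX0 mulr1.
by apply: big1 => j _; rewrite mderivX mnm1E eq_sym (negPf ki) scale0r mulr0 scaler0.
Qed.

Lemma DmDl A B p : Dm (A + B) p = Dm A p + Dm B p.
Proof.
rewrite /Dm -big_split; apply: eq_bigr => i _; rewrite -big_split.
by apply: eq_bigr => j _; rewrite mxE scalerDl.
Qed.

Lemma DmZl c A p : Dm (c *: A) p = c *: Dm A p.
Proof.
rewrite /Dm scaler_sumr; apply: eq_bigr => i _; rewrite scaler_sumr.
by apply: eq_bigr => j _; rewrite mxE scalerA.
Qed.

Lemma Dm0l p : Dm 0 p = 0.
Proof. by rewrite -(scale0r (0 : 'M[R]_n)) DmZl scale0r. Qed.

(** The Leibniz rule along [phi] carries the vanishing from the variables to all monomials.
    Identities between operators can thus be checked on the variables. *)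
Lemma derivation_eq0 (Q : comAlgType R) (phi D : {mpoly R[n]} -> Q) :
  linear D -> phi 1 = 1 -> (forall p q, D (p * q) = D p * phi q + phi p * D q) ->
  (forall i, D 'X_i = 0) -> forall p, D p = 0.
Proof.
move=> linD phi1 LD DX.
have D0 : D 0 = 0.
  by have := linD (-1) 0 0; rewrite scaler0 addr0 scaleN1r addNr.
have D1 : D 1 = 0.
  have := LD 1 1; rewrite !mulr1 phi1 mulr1 mul1r => /eqP.
  by rewrite -subr_eq0 opprD addNKr oppr_eq0 => /eqP.
have DM p q : D p = 0 -> D q = 0 -> D (p * q) = 0.
  by move=> Dp Dq; rewrite LD Dp Dq mul0r mulr0 addr0.
elim/mpolyind => // c m p _ _ Dp; rewrite linD Dp addr0.
rewrite mpolyXE_id; apply/eqP; rewrite scaler_eq0; apply/orP; right; apply/eqP.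
elim/big_rec: _ => // i x _ Dx; apply: (DM) => //.
by elim: (m i) => [|k IH] //; rewrite exprS; apply: (DM).
Qed.

(** A commutator of derivations is a derivation, so the variables suffice. There [Dm A] after [Dm B]
    acts by the matrix [B *m A], whence the reversed order. *)
Lemma Dm_commutator A B p : Dm A (Dm B p) - Dm B (Dm A p) = Dm (B *m A - A *m B) p.
Proof.
have Leibniz_commutator (P : comNzRingType) (x y a b a' b' u v u' v' w w' : P) :
    (u * y + b * a') + (a * b' + x * u') - ((v * y + a * b') + (b * a' + x * v')) -
    (w * y + x * w') = (u - v - w) * y + x * (u' - v' - w') by ring.
have linear_commutator (V : lmodType R) (c : R) (a b d x y z : V) :
    (c *: a + x) - (c *: b + y) - (c *: d + z) = c *: (a - b - d) + (x - y - z).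
  by rewrite !scalerBr !opprD (addrACA (c *: a)) (addrACA (c *: a - c *: b)).
apply/eqP; rewrite -subr_eq0; apply/eqP; move: p.
apply: (@derivation_eq0 _ idfun) => //.
- by move=> c p q; rewrite !(linearP (Dm _)) /= linear_commutator.
- by move=> p q; rewrite !DmM !(linearD (Dm _)) /= !DmM Leibniz_commutator.
move=> i; rewrite !Dm_X (linear_sum (Dm A)) (linear_sum (Dm B)) /=.
have E (C D : 'M[R]_n) : \sum_j Dm C (D i j *: 'X_j) =
    \sum_j (D *m C) i j *: 'X_j.
  under eq_bigr do rewrite linearZ_LR /= Dm_X scaler_sumr.
  rewrite exchange_big; apply: eq_bigr => j _; rewrite mxE scaler_suml.
  by apply: eq_bigr => k _; rewrite scalerA.
rewrite !E.
by rewrite -!sumrB big1 // => j _; rewrite !mxE scalerBl subrr.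
Qed.

Lemma homog_pser (f : ser R n) d : (forall e, Defs.mdeg e != d -> f e = 0) ->
  exists p, pser p = f.
Proof.
move=> fd; exists (\sum_(m : 'X_{1..n < d.+1}) f (expo_of_mnm m) *: 'X_[m]).
apply/funext => e; rewrite /pser.
have [le_ed|lt_de] := ltnP (mpoly.mdeg (mnm_of_expo e)) d.+1.
  by rewrite (mcoeff_mpoly (fun m => f (expo_of_mnm m)) le_ed) mnm_of_expoK.
rewrite fd; last by rewrite -mdeg_mnm_of_expo; lia.
rewrite raddf_sum big1 // => m _ /=; rewrite mcoeffZ mcoeffX.
case: eqP => [E|_]; last by rewrite mulr0.
by have := bmdeg m; rewrite E; lia.
Qed.

End Bridge.

(** * Polynomials in the joint variables *)

Section Tensor.
Variables (R : realType) (n m : nat).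
Implicit Types (e : expo (n + m)).

Definition inl_mpoly (p : {mpoly R[n]}) : {mpoly R[n + m]} :=
  p \mPo [tuple 'X_(lshift m i) | i < n].
Definition inr_mpoly (p : {mpoly R[m]}) : {mpoly R[n + m]} :=
  p \mPo [tuple 'X_(rshift n j) | j < m].

Lemma inl_mpolyX i : inl_mpoly 'X_i = 'X_(lshift m i).
Proof. by rewrite /inl_mpoly comp_mpolyXU -tnth_nth tnth_mktuple. Qed.

Lemma inr_mpolyX j : inr_mpoly 'X_j = 'X_(rshift n j).
Proof. by rewrite /inr_mpoly comp_mpolyXU -tnth_nth tnth_mktuple. Qed.

Definition exl e : expo n := [ffun i => e (lshift m i)].
Definition exr e : expo m := [ffun j => e (rshift n j)].

Lemma mcoeff_inl_inr (k : 'X_{1..n}) (l : 'X_{1..m}) e :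
  pser (inl_mpoly 'X_[k] * inr_mpoly 'X_[l]) e =
  ((k == mnm_of_expo (exl e)) && (l == mnm_of_expo (exr e)))%:R.
Proof.
pose kl : 'X_{1..n + m} :=
  [multinom match split i with inl i => k i | inr j => l j end | i < n + m].
have -> : inl_mpoly 'X_[k] * inr_mpoly 'X_[l] = 'X_[kl].
  rewrite /inl_mpoly /inr_mpoly !comp_mpolyX [in RHS]mpolyXE_id big_split_ord /=.
  congr (_ * _); apply: eq_bigr => i _; rewrite tnth_mktuple mnmE.
    by rewrite (unsplitK (inl i)).
  by rewrite (unsplitK (inr i)).
rewrite /pser mcoeffX; congr (_%:R); congr nat_of_bool.
apply/eqP/andP => [/mnmP E|[/eqP kE /eqP lE]].
  split; apply/eqP/mnmP => i.
    by have := E (lshift m i); rewrite !mnmE ffunE (unsplitK (inl i)).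
  by have := E (rshift n i); rewrite !mnmE ffunE (unsplitK (inr i)).
apply/mnmP => i; rewrite !mnmE.
by case: split_ordP => j ->; rewrite ?kE ?lE mnmE ffunE.
Qed.

(** Bilinearity reduces this to monomials, where [mcoeff_inl_inr] gives the coefficients. *)
Lemma pser_tensor p q : pser (inl_mpoly p * inr_mpoly q) = tensor (pser p) (pser q).
Proof.
apply/funext => e; rewrite /tensor -/(exl e) -/(exr e).
rewrite [in LHS](mpolyE p) [in LHS](mpolyE q) /inl_mpoly /inr_mpoly !linear_sum /=.
transitivity (\sum_(k <- msupp p) \sum_(l <- msupp q)
    (p@_k * (k == mnm_of_expo (exl e))%:R) * (q@_l * (l == mnm_of_expo (exr e))%:R)).
  rewrite mulr_suml pser_sum; apply: eq_bigr => k _.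
  rewrite mulr_sumr pser_sum; apply: eq_bigr => l _.
  rewrite !linearZ /= -scalerAl -scalerAr scalerA pserZ mcoeff_inl_inr.
  by rewrite -mulnb natrM mulrACA.
rewrite -big_distrlr /=; congr (_ * _); rewrite /pser.
  by rewrite [RHS](_ : _ = (\sum_(k <- msupp p) p@_k *: 'X_[k])@_(mnm_of_expo (exl e)));
    [rewrite raddf_sum; apply: eq_bigr => k _; rewrite /= mcoeffZ mcoeffX | rewrite -mpolyE].
by rewrite [RHS](_ : _ = (\sum_(k <- msupp q) q@_k *: 'X_[k])@_(mnm_of_expo (exr e)));
  [rewrite raddf_sum; apply: eq_bigr => k _; rewrite /= mcoeffZ mcoeffX | rewrite -mpolyE].
Qed.

Lemma inl_mpoly1 : inl_mpoly 1 = 1. Proof. exact: rmorph1. Qed.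
Lemma inr_mpoly1 : inr_mpoly 1 = 1. Proof. exact: rmorph1. Qed.
Lemma inl_mpolyM p q : inl_mpoly (p * q) = inl_mpoly p * inl_mpoly q.
Proof. exact: rmorphM. Qed.
Lemma inr_mpolyM p q : inr_mpoly (p * q) = inr_mpoly p * inr_mpoly q.
Proof. exact: rmorphM. Qed.

(** The difference of the two sides is a derivation along [inl_mpoly] that vanishes on the
    variables. *)
Lemma Dm_inl (A : 'M[R]_n) (B : 'M[R]_m) p :
  Dm (block_mx A 0 0 B) (inl_mpoly p) = inl_mpoly (Dm A p).
Proof.
apply/eqP; rewrite -subr_eq0; apply/eqP; move: p.
apply: (@derivation_eq0 _ _ _ inl_mpoly); first 2 last.
- by move=> p q; rewrite inl_mpolyM !DmM /inl_mpoly linearD !rmorphM /= mulrBl mulrBr opprD addrACA.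
- move=> i; rewrite inl_mpolyX !Dm_X big_split_ord /= [X in _ + X - _]big1 ?addr0 => [|j _].
    rewrite /inl_mpoly (linear_sum (comp_mpoly _)) -sumrB big1 // => j _.
    by rewrite block_mxEul linearZ /= -/(inl_mpoly 'X_j) inl_mpolyX subrr.
  by rewrite block_mxEur mxE scale0r.
- move=> c p q; rewrite /inl_mpoly !(linearP (comp_mpoly _)) !(linearP (Dm _)) /=.
  by rewrite (linearP (comp_mpoly _)) scalerBr opprD addrACA.
exact: inl_mpoly1.
Qed.

Lemma Dm_inr (A : 'M[R]_n) (B : 'M[R]_m) p :
  Dm (block_mx A 0 0 B) (inr_mpoly p) = inr_mpoly (Dm B p).
Proof.
apply/eqP; rewrite -subr_eq0; apply/eqP; move: p.
apply: (@derivation_eq0 _ _ _ inr_mpoly); first 2 last.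
- by move=> p q; rewrite inr_mpolyM !DmM /inr_mpoly linearD !rmorphM /= mulrBl mulrBr opprD addrACA.
- move=> i; rewrite inr_mpolyX !Dm_X big_split_ord /= [X in X + _ - _]big1 ?add0r => [|j _].
    rewrite /inr_mpoly (linear_sum (comp_mpoly _)) -sumrB big1 // => j _.
    by rewrite block_mxEdr linearZ /= -/(inr_mpoly 'X_j) inr_mpolyX subrr.
  by rewrite block_mxEdl mxE scale0r.
- move=> c p q; rewrite /inr_mpoly !(linearP (comp_mpoly _)) !(linearP (Dm _)) /=.
  by rewrite (linearP (comp_mpoly _)) scalerBr opprD addrACA.
exact: inr_mpoly1.
Qed.

End Tensor.

(** * Local nilpotency *)

Section Nilpotent.
Variables (F : numFieldType) (n : nat).
Implicit Types A Z : 'M[F]_n.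

(* The powers of [A] are eigenvectors of [ad Z] for the distinct
   eigenvalues [c * k], of which there are finitely many. *)
Lemma nilpotent_of_commutator A Z (c : F) : c != 0 ->
  Z *m A - A *m Z = c *: A -> exists N, iter N (mulmx^~ A) 1%:M = 0.
Proof.
move=> c0 ZA; pose P k := iter k (mulmx^~ A) 1%:M : 'M[F]_n.
have PS k : P k.+1 = P k *m A by [].
have ZP k : Z *m P k - P k *m Z = (c * k%:R) *: P k.
  elim: k => [|k IH]; first by rewrite mulmx1 mul1mx subrr mulr0 scale0r.
  have -> : Z *m P k.+1 - P k.+1 *m Z =
      (Z *m P k - P k *m Z) *m A + P k *m (Z *m A - A *m Z).
    by rewrite PS mulmxBl mulmxBr !mulmxA addrA subrK.
  rewrite IH ZA PS -scalemxAl -scalemxAr -scalerDl; congr (_ *: _).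
  by rewrite mulrSr; ring.
apply/not_existsP => NP.
pose L : {linear 'M[F]_n -> 'M[F]_n} := mulmx Z \- mulmxr Z.
(* If no power vanishes, these are [n * n + 1] distinct eigenvalues of [ad Z], one more than the
   degree of its characteristic polynomial. *)
pose r := [seq c * k%:R | k <- iota 0 (n * n).+1].
have roots_r : all (root (char_poly (lin_mx L))) r.
  apply/allP => _ /mapP[k _ ->]; rewrite -eigenvalue_root_char; apply/eigenvalueP.
  exists (mxvec (P k)); last by rewrite mxvec_eq0; apply/eqP; apply: NP.
  by rewrite mul_vec_lin /= ZP linearZ.
have uniq_r : uniq r.
  rewrite map_inj_uniq ?iota_uniq // => i j /(mulfI c0) /eqP.
  by rewrite eqr_nat => /eqP.
have := max_poly_roots (monic_neq0 (char_poly_monic _)) roots_r uniq_r.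
by rewrite size_char_poly size_map size_iota ltnn.
Qed.

End Nilpotent.

(** On the variables [Dm A] acts through the matrix [A], so its iterate of order [N] vanishes there.
    Products are handled by [iter_derivation_eq0], and sums by the larger of two exponents. *)
Lemma Dm_locally_nilpotent (R : realType) n (A : 'M[R]_n) N (p : {mpoly R[n]}) :
  iter N (mulmx^~ A) 1%:M = 0 -> exists k, iter k (Dm A) p = 0.
Proof.
move=> AN.
have mono k l (q : {mpoly R[n]}) : (k <= l)%N -> iter k (Dm A) q = 0 -> iter l (Dm A) q = 0.
  by move=> kl q0; rewrite -(subnK kl) iterD q0 iter_linear0.
have nilM (q q' : {mpoly R[n]}) : (exists k, iter k (Dm A) q = 0) ->
    (exists k, iter k (Dm A) q' = 0) -> exists k, iter k (Dm A) (q * q') = 0.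
  move=> [k qk] [l ql]; exists (k + l).-1.
  exact: (iter_derivation_eq0 (DmM A) qk ql).
have nil1 : exists k, iter k (Dm A) 1 = 0.
  by exists 1%N; rewrite /= (derivation1 (DmM A)).
have nilX i : exists k, iter k (Dm A) 'X_i = 0.
  exists N.
  have -> : iter N (Dm A) 'X_i = \sum_j iter N (mulmx^~ A) 1%:M i j *: 'X_j.
    elim: (N) => [|k IH].
      rewrite (bigD1 i) //= mxE eqxx scale1r big1 ?addr0 // => j ji.
      by rewrite mxE eq_sym (negPf ji) scale0r.
    rewrite iterS IH (linear_sum (Dm A)) /=.
    under eq_bigr do rewrite linearZ_LR /= Dm_X scaler_sumr.
    rewrite exchange_big; apply: eq_bigr => j _; rewrite mxE scaler_suml.
    by apply: eq_bigr => l _; rewrite scalerA.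
  by rewrite AN big1 // => j _; rewrite mxE scale0r.
elim/mpolyind: p => [|c m p _ _ [k pk]]; first by exists 0%N.
have [l ml] : exists l, iter l (Dm A) 'X_[m] = 0.
  rewrite mpolyXE_id; elim/big_rec: _ => // i x _ Dx; apply: (nilM) => //.
  by elim: (m i) => [|j IH]; rewrite ?expr0 // exprS; apply: (nilM).
exists (maxn k l); rewrite iter_linearD iter_linearZ.
by rewrite (mono _ _ _ (leq_maxl _ _) pk) (mono _ _ _ (leq_maxr _ _) ml) scaler0 addr0.
Qed.

(** * Triads of matrices and of operators *)

Section Triad.
Variables (R : realType).

(** The zero triad fills the other diagonal block, so that the operators on one group of variables
    also come from a triad on all variables. *)
Lemma sl2_triad0 n : sl2_triad (0 : 'M[R]_n) 0 0.
Proof. by split; rewrite ?mul0mx ?subrr ?scaler0 ?oppr0. Qed.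

Lemma mulmx_diag_block n m (A A' : 'M[R]_n) (B B' : 'M[R]_m) :
  block_mx A 0 0 B *m block_mx A' 0 0 B' = block_mx (A *m A') 0 0 (B *m B').
Proof. by rewrite mulmx_block !mulmx0 !mul0mx !addr0 !add0r. Qed.

Lemma sl2_triad_block n m (X Y Z : 'M[R]_n) (X' Y' Z' : 'M[R]_m) :
  sl2_triad X Y Z -> sl2_triad X' Y' Z' ->
  sl2_triad (block_mx X 0 0 X') (block_mx Y 0 0 Y') (block_mx Z 0 0 Z').
Proof.
case=> XY ZX ZY [XY' ZX' ZY']; split;
  rewrite !mulmx_diag_block opp_block_mx add_block_mx !subr0.
- by rewrite XY XY'.
- by rewrite ZX ZX' scale_block_mx !scaler0.
- by rewrite ZY ZY' scale_block_mx opp_block_mx !scaler0 !oppr0.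
Qed.

Variables (n : nat) (X Y Z : 'M[R]_n).
Hypothesis XYZ : sl2_triad X Y Z.

(* [A |-> Dm A] reverses commutators, so the triad of operators is
   [(Dm Y, Dm X, Dm Z)]. *)
Lemma Dm_XY p : Dm Y (Dm X p) = Dm X (Dm Y p) + Dm Z p.
Proof. by case: XYZ => XY _ _; rewrite -XY -Dm_commutator addrC subrK. Qed.

Lemma Dm_ZX p : Dm Z (Dm Y p) = Dm Y (Dm Z p) + 2%:R *: Dm Y p.
Proof.
case: XYZ => _ _ ZY; rewrite -DmZl -[2%:R *: Y]opprK -ZY opprB -Dm_commutator.
by rewrite addrC subrK.
Qed.

Lemma Dm_ZY p : Dm Z (Dm X p) = Dm X (Dm Z p) - 2%:R *: Dm X p.
Proof.
case: XYZ => _ ZX _; rewrite -DmZl -ZX.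
have -> : Dm (Z *m X - X *m Z) p = Dm X (Dm Z p) - Dm Z (Dm X p).
  by rewrite Dm_commutator.
by rewrite opprB addrC subrK.
Qed.

(** [X] and [Y] are eigenvectors of [ad Z] for 2 and -2, hence nilpotent matrices. *)
Lemma Dm_triad_nilpotent p :
  (exists k, iter k (Dm X) p = 0) /\ (exists k, iter k (Dm Y) p = 0).
Proof.
case: XYZ => _ ZX; rewrite -scaleNr => ZY; split.
  have [|N XN] := nilpotent_of_commutator _ ZX; first by rewrite pnatr_eq0.
  exact: Dm_locally_nilpotent XN.
have [|N YN] := nilpotent_of_commutator _ ZY; first by rewrite oppr_eq0 pnatr_eq0.
exact: Dm_locally_nilpotent YN.
Qed.

End Triad.

(** * Homogeneous series *)

Section Homogeneous.
Variable R : realType.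

Definition hom_ser n d (f : ser R n) := forall e, Defs.mdeg e != d -> f e = 0.

Lemma hom_smul n a b (f g : ser R n) : hom_ser a f -> hom_ser b g -> hom_ser (a + b)%N (smul f g).
Proof.
move=> fa gb e ne; rewrite /smul big1 // => u /forallP ule.
have [E|/fa ->] := eqVneq (Defs.mdeg [ffun i => nat_of_ord (u i)]) a; last by rewrite mul0r.
rewrite gb ?mulr0 //; apply: contra ne => /eqP Eb.
rewrite -E -Eb /Defs.mdeg -big_split /=; apply/eqP/eq_bigr => i _.
by rewrite !ffunE subnKC.
Qed.

Lemma hom_sone n : hom_ser 0 (@sone R n).
Proof.
move=> e ne; rewrite /sone; case: eqP => // E; move: ne.
by rewrite E /Defs.mdeg big1 // => i _; rewrite ffunE.
Qed.

Lemma hom_smon n p (a : 'I_p -> ser R n) (d : 'I_p -> nat) (k : expo p) :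
  (forall i, hom_ser (d i) (a i)) -> hom_ser (\sum_i d i * k i)%N (smon a k).
Proof.
move=> ad; rewrite /smon; elim/big_rec2: _ => [|i x y _ IH]; first exact: hom_sone.
apply: hom_smul => //; elim: (k i) => [|j IHj]; first by rewrite muln0; exact: hom_sone.
by rewrite mulnS; apply: hom_smul.
Qed.

Lemma mdeg_incr_decr n (i j : 'I_n) (e : expo n) : (0 < e j)%N ->
  Defs.mdeg (incr i (decr j e)) = Defs.mdeg e.
Proof.
move=> ej; rewrite /Defs.mdeg.
have S1 k : (\sum_l (l == k :> 'I_n) = 1)%N.
  by rewrite (bigD1 k) //= eqxx big1 ?addn0 // => l /negPf ->.
have E : (\sum_l (decr j e l + (l == j)) = \sum_l e l)%N.
  by apply: eq_bigr => l _; rewrite ffunE; case: eqP => [->|]; rewrite ?subn0 ?addn0 // subn1 addn1 prednK.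
rewrite -E !big_split /= S1 -(S1 i) -big_split; apply: eq_bigr => l _.
by rewrite !ffunE.
Qed.

Lemma hom_Dop n d (A : 'M[R]_n) f : hom_ser d f -> hom_ser d (Dop A f).
Proof.
move=> fd e ne; rewrite /Dop big1 // => i _; rewrite big1 // => j _.
by case: ifP => // ej; rewrite fd ?mulr0 // mdeg_incr_decr.
Qed.

Lemma hom_iter_Dop n d (A : 'M[R]_n) f k : hom_ser d f -> hom_ser d (iter k (Dop A) f).
Proof. by move=> fd; elim: k => //= k; apply: hom_Dop. Qed.

Lemma mdeg_exl_exr n m (e : expo (n + m)) : Defs.mdeg e = (Defs.mdeg (exl e) + Defs.mdeg (exr e))%N.
Proof.
rewrite /Defs.mdeg big_split_ord /=.
by congr (_ + _)%N; apply: eq_bigr => i _; rewrite ffunE.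
Qed.

Lemma hom_tensor n m a b (f : ser R n) (g : ser R m) :
  hom_ser a f -> hom_ser b g -> hom_ser (a + b)%N (tensor f g).
Proof.
move=> fa gb e ne; rewrite /tensor -/(exl e) -/(exr e).
have [E|/fa ->] := eqVneq (Defs.mdeg (exl e)) a; last by rewrite mul0r.
rewrite gb ?mulr0 //; apply: contra ne => /eqP Eb.
by rewrite -E -Eb mdeg_exl_exr.
Qed.

Definition hom_part n d (f : ser R n) : ser R n := fun e => if Defs.mdeg e == d then f e else 0.

Lemma hom_hom_part n d (f : ser R n) : hom_ser d (hom_part d f).
Proof. by move=> e; rewrite /hom_part => /negPf ->. Qed.

(** These operators preserve the degree. Hence the homogeneous parts of a kernel element lie in the
    kernel, which reduces the theorem to polynomials. *)
Lemma Dop_hom_part n d (A : 'M[R]_n) f e : Dop A (hom_part d f) e = hom_part d (Dop A f) e.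
Proof.
rewrite /hom_part /Dop; case: ifP => ed.
  apply: eq_bigr => i _; apply: eq_bigr => j _; case: ifP => // ej.
  by rewrite mdeg_incr_decr // ed.
rewrite big1 // => i _; rewrite big1 // => j _; case: ifP => // ej.
by rewrite mdeg_incr_decr // ed mulr0.
Qed.

(** [formal_comb] yields an unknown finite list for each coefficient; this exchanges it for an
    explicit one. *)
Lemma eq_sum_support (K : eqType) (s s' : seq K) (F : K -> R) :
  uniq s -> uniq s' -> (forall k, k \notin s -> F k = 0) ->
  (forall k, k \notin s' -> F k = 0) -> \sum_(k <- s) F k = \sum_(k <- s') F k.
Proof.
move=> us us' Fs Fs'.
have E t : \sum_(k <- t) F k = \sum_(k <- [seq k <- t | F k != 0]) F k.
  by rewrite big_filter [RHS]big_mkcond; apply: eq_bigr => k _; case: eqP.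
have supp t k : (forall k, k \notin t -> F k = 0) -> F k != 0 -> k \in t.
  by move=> Ft; apply: contraNT => /Ft ->.
rewrite (E s) (E s'); apply/perm_big/uniq_perm; rewrite ?filter_uniq // => k.
by rewrite !mem_filter; case: eqVneq => //= Fk; rewrite !supp.
Qed.


Definition box p d : seq (expo p) :=
  [seq [ffun i => nat_of_ord (g i)] | g : {ffun 'I_p -> 'I_d.+1} <- enum {ffun 'I_p -> 'I_d.+1}].

Lemma box_uniq p d : uniq (box p d).
Proof.
rewrite map_inj_uniq ?enum_uniq // => g g' /ffunP E; apply/ffunP => i.
by have := E i; rewrite !ffunE => /val_inj.
Qed.

Lemma mem_box p d (k : expo p) : (k \in box p d) = [forall i, (k i <= d)%N].
Proof.
apply/mapP/forallP => [[g _ ->] i|kd]; first by rewrite ffunE -ltnS.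
exists [ffun i => inord (k i)]; first by rewrite mem_enum.
by apply/ffunP => i; rewrite !ffunE inordK // ltnS.
Qed.

Lemma Dop_sum n (A : 'M[R]_n) (I : Type) (r : seq I) (c : I -> R) (f : I -> ser R n) e :
  Dop A (fun e => \sum_(k <- r) c k * f k e) e = \sum_(k <- r) c k * Dop A (f k) e.
Proof.
rewrite /Dop; under [RHS]eq_bigr do rewrite mulr_sumr.
rewrite [RHS]exchange_big; apply: eq_bigr => i _ /=.
under [RHS]eq_bigr do rewrite mulr_sumr.
rewrite [RHS]exchange_big; apply: eq_bigr => j _ /=.
case: ifP => _; last by rewrite big1 // => k _; rewrite mulr0.
by rewrite mulr_sumr; apply: eq_bigr => k _; ring.
Qed.

End Homogeneous.

(** * Slices of a series: one group of exponents held fixed *)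

Section Slices.
Variables (R : realType) (n m : nat).

Definition cat_expo (x : expo n) (y : expo m) : expo (n + m) :=
  [ffun i => match split i with inl j => x j | inr j => y j end].

Lemma cat_expo_l x y i : cat_expo x y (lshift m i) = x i.
Proof. by rewrite ffunE (unsplitK (inl i)). Qed.

Lemma cat_expo_r x y i : cat_expo x y (rshift n i) = y i.
Proof. by rewrite ffunE (unsplitK (inr i)). Qed.

Lemma exl_cat x y : exl (cat_expo x y) = x.
Proof. by apply/ffunP => i; rewrite ffunE cat_expo_l. Qed.

Lemma exr_cat x y : exr (cat_expo x y) = y.
Proof. by apply/ffunP => i; rewrite ffunE cat_expo_r. Qed.

Lemma cat_exl_exr e : cat_expo (exl e) (exr e) = e.
Proof. by apply/ffunP => i; rewrite ffunE; case: split_ordP => j ->; rewrite ffunE. Qed.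

Lemma decr_cat_l j x y : decr (lshift m j) (cat_expo x y) = cat_expo (decr j x) y.
Proof.
apply/ffunP => i; rewrite /decr /cat_expo !ffunE; case: split_ordP => k ->.
  by rewrite eq_lshift ffunE.
by rewrite eq_rlshift subn0.
Qed.

Lemma incr_cat_l j x y : incr (lshift m j) (cat_expo x y) = cat_expo (incr j x) y.
Proof.
apply/ffunP => i; rewrite /incr /cat_expo !ffunE; case: split_ordP => k ->.
  by rewrite eq_lshift ffunE.
by rewrite eq_rlshift addn0.
Qed.

Lemma decr_cat_r j x y : decr (rshift n j) (cat_expo x y) = cat_expo x (decr j y).
Proof.
apply/ffunP => i; rewrite /decr /cat_expo !ffunE; case: split_ordP => k ->.
  by rewrite eq_lrshift subn0.
by rewrite eq_rshift ffunE.
Qed.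

Lemma incr_cat_r j x y : incr (rshift n j) (cat_expo x y) = cat_expo x (incr j y).
Proof.
apply/ffunP => i; rewrite /incr /cat_expo !ffunE; case: split_ordP => k ->.
  by rewrite eq_lrshift addn0.
by rewrite eq_rshift ffunE.
Qed.

(** The zero blocks contribute nothing, so the exponents [y] are mere parameters. *)
Lemma Dop_slice_l (A : 'M[R]_n) (F : ser R (n + m)) x y :
  Dop (block_mx A 0 0 0) F (cat_expo x y) = Dop A (fun x => F (cat_expo x y)) x.
Proof.
rewrite /Dop big_split_ord /= [X in _ + X]big1 ?addr0 => [|i _].
  apply: eq_bigr => i _; rewrite big_split_ord /= [X in _ + X]big1 ?addr0 => [|j _].
    apply: eq_bigr => j _; rewrite block_mxEul cat_expo_l decr_cat_l cat_expo_l.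
    by rewrite incr_cat_l.
  by rewrite block_mxEur mxE !mul0r if_same.
apply: big1 => j _; case: (split_ordP j) => k ->.
  by rewrite block_mxEdl mxE !mul0r if_same.
by rewrite block_mxEdr mxE !mul0r if_same.
Qed.

Lemma Dop_slice_r (B : 'M[R]_m) (F : ser R (n + m)) x y :
  Dop (block_mx 0 0 0 B) F (cat_expo x y) = Dop B (fun y => F (cat_expo x y)) y.
Proof.
rewrite /Dop big_split_ord /= [X in X + _]big1 ?add0r => [|i _].
  apply: eq_bigr => i _; rewrite big_split_ord /= [X in X + _]big1 ?add0r => [|j _].
    apply: eq_bigr => j _; rewrite block_mxEdr cat_expo_r decr_cat_r cat_expo_r.
    by rewrite incr_cat_r.
  by rewrite block_mxEdl mxE !mul0r if_same.
apply: big1 => j _; case: (split_ordP j) => k ->.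
  by rewrite block_mxEul mxE !mul0r if_same.
by rewrite block_mxEur mxE !mul0r if_same.
Qed.

End Slices.

(** * Kernels *)

Section Kernel.
Variables (R : realType) (n : nat) (MX : 'M[R]_n) (p : nat).
Variables (u : 'I_p -> {mpoly R[n]}) (A : expo p -> Prop) (d : 'I_p -> nat).
Let a i := pser (u i).
Hypothesis spA : standard_preferred_set MX a A.
Hypothesis hom_a : forall i, hom_ser (d i) (a i).

Definition expo_deg (k : expo p) := (\sum_i d i * k i)%N.

(* A generator of degree 0 is a constant, hence linearly dependent on [1]. *)
Lemma admissible_deg_gt0 k i : A k -> (0 < k i)%N -> (0 < d i)%N.
Proof.
case: spA => -[inj indep _] std Ak ki; rewrite lt0n; apply/eqP => di.
pose k0 : expo p := [ffun=> 0%N]; pose k1 : expo p := [ffun j => nat_of_bool (j == i)].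
(* Standardness puts the exponents of [1] and of the generator itself, both below [k], into [A]. *)
have A0 : A k0 by apply: std Ak _ => j; rewrite ffunE.
have A1 : A k1.
  by apply: std Ak _ => j; rewrite ffunE; case: eqP => [->|].
have k01 : k1 != k0 by apply/eqP => /ffunP/(_ i); rewrite !ffunE eqxx.
have a1 : smon a k1 = a i.
  rewrite -pser_smon (bigD1 i) //= ffunE eqxx big1 ?mulr1 // => j /negPf ji.
  by rewrite ffunE ji.
have a0 : smon a k0 = @sone R n.
  by rewrite -pser_smon -pser1 big1 // => j _; rewrite ffunE.
pose c := a i [ffun=> 0%N].
have : (if k1 == k1 then 1 else - c) = 0 :> R.
  apply: (indep [:: k1; k0] (fun k => if k == k1 then 1 else - c)).
  - by rewrite /= inE k01.
  - by move=> l; rewrite !inE => /orP[] /eqP ->.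
  - move=> e; rewrite big_cons big_seq1 eqxx eq_sym (negPf k01) a1 a0 mul1r /sone.
    case: eqP => [->|ne]; first by rewrite mulr1 subrr.
    rewrite mulr0 addr0 (hom_a _) // di; apply: contra_notN ne.
    rewrite /Defs.mdeg sum_nat_eq0 => /forallP e0; apply/ffunP => j.
    by rewrite ffunE; apply/eqP; exact: e0.
  - by rewrite inE eqxx.
by rewrite eqxx => /eqP; rewrite oner_eq0.
Qed.

(** The generators that occur have positive degree. So each degree has finitely many admissible
    exponents, and filtering [box] below misses none. *)
Lemma le_expo_deg k i : A k -> (k i <= expo_deg k)%N.
Proof.
move=> Ak; have [->|] := posnP (k i) => // ki.
rewrite /expo_deg (bigD1 i) //= (leq_trans _ (leq_addr _ _)) //.
by rewrite leq_pmull // (admissible_deg_gt0 Ak ki).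
Qed.

Definition klist D := [seq k <- box p D | `[<A k>] && (expo_deg k == D)].
Definition klist_le D := [seq k <- box p D | `[<A k>] && (expo_deg k <= D)%N].

Lemma klist_uniq D : uniq (klist D). Proof. by rewrite filter_uniq ?box_uniq. Qed.
Lemma klist_le_uniq D : uniq (klist_le D). Proof. by rewrite filter_uniq ?box_uniq. Qed.

Lemma mem_klist D k : (k \in klist D) = `[<A k>] && (expo_deg k == D).
Proof.
rewrite mem_filter; case: asboolP => //= Ak; case: eqP => //= <-.
by rewrite mem_box; apply/forallP => i; apply: le_expo_deg.
Qed.

Lemma mem_klist_le D k : (k \in klist_le D) = `[<A k>] && (expo_deg k <= D)%N.
Proof.
rewrite mem_filter; case: asboolP => //= Ak; case: leqP => //= kD.
by rewrite mem_box; apply/forallP => i; apply: leq_trans kD; apply: le_expo_deg.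
Qed.

Lemma hom_smon_expo k : hom_ser (expo_deg k) (smon a k).
Proof. exact: hom_smon. Qed.

(** Monomials of degree other than [D] do not contribute to the coefficients of degree [D], so the
    formal combination can be cut down to one finite list. *)
Lemma hom_in_ker D f : in_ker MX f -> hom_ser D f ->
  exists c : expo p -> R, forall e, f e = \sum_(k <- klist D) c k * smon a k e.
Proof.
case: spA => -[_ _ span] _ kf fD; have [c [cA cs]] := span f kf.
exists c => e; have [eD|neD] := eqVneq (Defs.mdeg e) D; last first.
  rewrite fD // big_seq big1 // => k; rewrite mem_klist => /andP[_ /eqP kD].
  by rewrite hom_smon_expo ?mulr0 // kD.
have [s [us s0 ->]] := cs e.
apply: eq_sum_support => // [|k]; first exact: klist_uniq.
rewrite mem_klist negb_and => /orP[/asboolP/cA ->|kD]; first by rewrite mul0r.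
by rewrite hom_smon_expo ?mulr0 // eD eq_sym.
Qed.

Lemma smon_indep (s : seq (expo p)) (c : expo p -> R) : uniq s ->
  (forall k, k \in s -> A k) -> (forall e, \sum_(k <- s) c k * smon a k e = 0) ->
  forall k, k \in s -> c k = 0.
Proof. by case: spA => -[_ indep _] _; apply: indep. Qed.

End Kernel.

(** * The common kernel of the operators on the two groups of variables *)

Section TensorKernel.
Variables (R : realType) (n m : nat) (MX : 'M[R]_n) (MX' : 'M[R]_m) (p q : nat).
Variables (u : 'I_p -> {mpoly R[n]}) (A : expo p -> Prop) (d : 'I_p -> nat).
Variables (v : 'I_q -> {mpoly R[m]}) (B : expo q -> Prop) (d' : 'I_q -> nat).
Let a i := pser (u i).
Let b j := pser (v j).
Hypothesis spA : standard_preferred_set MX a A.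
Hypothesis hom_a : forall i, hom_ser (d i) (a i).
Hypothesis spB : standard_preferred_set MX' b B.
Hypothesis hom_b : forall i, hom_ser (d' i) (b i).

(** For fixed [y] this is a relation among the monomials in [a], whose coefficients therefore
    vanish. As [y] varies, these are relations among the monomials in [b]. *)
Lemma tensor_indep (s : seq (expo p)) (t : expo p -> seq (expo q)) (c : expo p -> expo q -> R) :
  uniq s -> (forall k, k \in s -> A k) ->
  (forall k, uniq (t k)) -> (forall k l, l \in t k -> B l) ->
  (forall e, \sum_(k <- s) \sum_(l <- t k) c k l * tensor (smon a k) (smon b l) e = 0) ->
  forall k l, k \in s -> l \in t k -> c k l = 0.
Proof.
move=> us sA ut tB H k l ks lt.
apply: (smon_indep spB (ut k) (@tB k)) lt => y.
apply: (smon_indep (c := fun k => \sum_(l <- t k) c k l * smon b l y) spA us sA _ ks) => x.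
rewrite -[RHS](H (cat_expo x y)).
apply: eq_bigr => k' _; rewrite mulr_suml; apply: eq_bigr => l' _.
by rewrite /tensor -/(exl _) -/(exr _) exl_cat exr_cat; ring.
Qed.

(** The slice at each [y] is expanded in the monomials in [a]. Its coefficients, as series in [y],
    lie in the kernel of [MX'] and are expanded in the monomials in [b]. *)
Lemma hom_in_ker_tensor D (F : ser R (n + m)) : hom_ser D F ->
  in_ker (block_mx MX 0 0 0) F -> in_ker (block_mx 0 0 0 MX') F ->
  exists c : expo p -> expo q -> R, forall e, F e =
    \sum_(k <- klist_le A d D) \sum_(l <- klist B d' (D - expo_deg d k)%N)
      c k l * tensor (smon a k) (smon b l) e.
Proof.
move=> FD F1 F2.
have slice y : exists c : expo p -> R,
    (forall x, F (cat_expo x y) = \sum_(k <- klist_le A d D) c k * smon a k x) /\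
    (forall k, Defs.mdeg y != (D - expo_deg d k)%N -> c k = 0).
  have mdegxy x : Defs.mdeg (cat_expo x y) = (Defs.mdeg x + Defs.mdeg y)%N.
    by rewrite mdeg_exl_exr exl_cat exr_cat.
  have [le_yD|lt_Dy] := leqP (Defs.mdeg y) D; last first.
    exists (fun _ => 0); split=> // x; rewrite big1 => [|k _]; last by rewrite mul0r.
    by rewrite FD // mdegxy; lia.
  have [||c cE] := @hom_in_ker _ _ _ _ _ _ _ spA hom_a (D - Defs.mdeg y)%N
      (fun x => F (cat_expo x y)).
  - by move=> x; rewrite -Dop_slice_l.
  - by move=> x xD; rewrite FD // mdegxy; lia.
  (* Coefficients outside the relevant degree are set to 0, so that [c y k] is homogeneous as a
     series in [y]. *)
  exists (fun k => if k \in klist A d (D - Defs.mdeg y)%N then c k else 0); split=> [x|k].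
    rewrite cE.
    transitivity (\sum_(k <- klist A d (D - Defs.mdeg y)%N)
        (if k \in klist A d (D - Defs.mdeg y)%N then c k else 0) * smon a k x).
      by rewrite !big_seq; apply: eq_bigr => k ->.
    apply: eq_sum_support => [||k /negPf ->|k].
    - exact: klist_uniq.
    - exact: klist_le_uniq.
    - by rewrite mul0r.
    rewrite (mem_klist_le spA hom_a) (mem_klist spA hom_a).
    case: asboolP => //= Ak; last by rewrite mul0r.
    by case: eqP => [->|]; rewrite ?mul0r // leq_subr.
  rewrite (mem_klist spA hom_a); case: ifP => // /andP[_ /eqP ->].
  by rewrite subKn // eqxx.
have /choice[c cP] := slice.
(* Applying the second operator to the expansion of [F] gives a vanishing combination of independent
   monomials in [a], so it annihilates each coefficient. *)
have c_ker k : k \in klist_le A d D -> in_ker MX' (fun y => c y k).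
  move=> kD y.
  apply: (smon_indep (c := fun k => Dop MX' (fun y => c y k) y) spA
    (klist_le_uniq A d D) _ _ kD).
    by move=> k'; rewrite (mem_klist_le spA hom_a) => /andP[/asboolP].
  move=> x; rewrite -[RHS](F2 (cat_expo x y)) Dop_slice_r.
  have -> : (fun y => F (cat_expo x y)) =
      fun y => \sum_(k <- klist_le A d D) smon a k x * c y k.
    by apply/funext => y'; rewrite (cP y').1; apply: eq_bigr => k' _; rewrite mulrC.
  by rewrite Dop_sum; apply: eq_bigr => k' _; rewrite mulrC.
have c_hom k : hom_ser (D - expo_deg d k)%N (fun y => c y k).
  by move=> y; apply: (cP y).2.
have ex_c' k : exists c' : expo q -> R, k \in klist_le A d D -> forall y, c y k =
    \sum_(l <- klist B d' (D - expo_deg d k)%N) c' l * smon b l y.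
  case kD : (k \in klist_le A d D); last by exists (fun _ => 0).
  by have [c' c'E] := hom_in_ker spB hom_b (c_ker k kD) (@c_hom k); exists c'.
have /choice[c' c'P] := ex_c'.
exists c' => e; rewrite -{1}(cat_exl_exr e) (cP _).1 !big_seq; apply: eq_bigr => k kD.
rewrite (c'P k kD) mulr_suml; apply: eq_bigr => l _.
by rewrite /tensor -/(exl e) -/(exr e); ring.
Qed.

End TensorKernel.

(** * The transvectant cone *)

Section Cone.
Variables (p q : nat) (wa : 'I_p -> int) (wb : 'I_q -> int).
Variables (A : expo p -> Prop) (B : expo q -> Prop).
Hypothesis stdA : forall k k' : expo p, A k -> (forall i, (k' i <= k i)%N) -> A k'.
Hypothesis stdB : forall k k' : expo q, B k -> (forall i, (k' i <= k i)%N) -> B k'.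
Implicit Types c : cel p q.

Lemma cadd0c c : cadd (czero p q) c = c.
Proof.
case: c => -[k l] s; rewrite /cadd /=; congr (_, _, _);
  by apply/ffunP => i; rewrite !ffunE.
Qed.

Lemma caddc0 c : cadd c (czero p q) = c.
Proof.
case: c => -[k l] s; rewrite /cadd /= addn0; congr (_, _, _);
  by apply/ffunP => i; rewrite !ffunE addn0.
Qed.

Lemma caddA c1 c2 c3 : cadd c1 (cadd c2 c3) = cadd (cadd c1 c2) c3.
Proof.
rewrite /cadd /= addnA; congr (_, _, _);
  by apply/ffunP => i; rewrite !ffunE addnA.
Qed.

Definition csize c := (Defs.mdeg c.1.1 + Defs.mdeg c.1.2 + c.2)%N.

Lemma csize_cadd c c' : csize (cadd c c') = (csize c + csize c')%N.
Proof.
have mdegD r (x y : expo r) : Defs.mdeg [ffun i => (x i + y i)%N] = (Defs.mdeg x + Defs.mdeg y)%N.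
  by rewrite /Defs.mdeg -big_split; apply: eq_bigr => i _; rewrite ffunE.
by rewrite /csize !mdegD /=; lia.
Qed.

Lemma csize_eq0 c : csize c = 0%N -> c = czero p q.
Proof.
have mdeg0 r (x : expo r) : Defs.mdeg x = 0%N -> x = [ffun=> 0%N].
  move/eqP; rewrite /Defs.mdeg sum_nat_eq0 => /forallP x0; apply/ffunP => i.
  by rewrite ffunE; apply/eqP/x0.
case: c => -[k l] s; rewrite /csize /= => /eqP; rewrite !addn_eq0.
by move=> /andP[/andP[/eqP/mdeg0 -> /eqP/mdeg0 ->] /eqP ->].
Qed.

Lemma foldr_cadd_cat s1 s2 : foldr (@cadd p q) (czero p q) (s1 ++ s2) =
  cadd (foldr (@cadd p q) (czero p q) s1) (foldr (@cadd p q) (czero p q) s2).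
Proof. by elim: s1 => [|c s IH]; rewrite ?cadd0c //= IH caddA. Qed.

(** Induction on [csize], which is additive and vanishes only at zero, so both parts of a proper
    decomposition are smaller. They lie componentwise below [c] and stay admissible by
    standardness. *)
Lemma admissible_sum_primes c : admissible wa wb A B c ->
  exists s : seq (cel p q), (forall d, d \in s -> admissible_prime wa wb A B d) /\
    c = foldr (@cadd p q) (czero p q) s.
Proof.
have [N leN] := ubnP (csize c); elim: N c leN => // N IH c leN adm_c.
have [c0|nc0] := pselect (c = czero p q); first by exists [::].
have [[d1 [d2 [C1 C2 n1 n2 E]]]|irr] := pselect (exists d1 d2,
  [/\ in_cone wa wb d1, in_cone wa wb d2, d1 <> czero p q, d2 <> czero p q & c = cadd d1 d2]); last first.
  exists [:: c]; rewrite /= caddc0; split=> // d; rewrite inE => /eqP ->.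
  by split=> //; split=> //; case: adm_c.
have s1 : csize d1 != 0%N by apply: contra_notN n1 => /eqP/csize_eq0.
have s2 : csize d2 != 0%N by apply: contra_notN n2 => /eqP/csize_eq0.
have sE : csize c = (csize d1 + csize d2)%N by rewrite E csize_cadd.
case: adm_c => _; rewrite E /= => Ac Bc.
have [||t1 [p1 E1]] := IH d1; first by lia.
  split=> //; [apply: (stdA Ac)|apply: (stdB Bc)] => i; rewrite ffunE; exact: leq_addr.
have [||t2 [p2 E2]] := IH d2; first by lia.
  split=> //; [apply: (stdA Ac)|apply: (stdB Bc)] => i; rewrite ffunE; exact: leq_addl.
exists (t1 ++ t2); rewrite foldr_cadd_cat -E1 -E2; split=> // d.
by rewrite mem_cat => /orP[/p1|/p2].
Qed.

End Cone.

(** * Leading terms of products of transvectants *)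

Lemma pser_iter_Dm (R : realType) n (A : 'M[R]_n) k p :
  pser (iter k (Dm A) p) = iter k (Dop A) (pser p).
Proof. by elim: k => //= k <-; rewrite pser_Dm. Qed.

Lemma hom_iter_Dm (R : realType) n (A : 'M[R]_n) k d p :
  hom_ser d (pser p) -> hom_ser d (pser (iter k (Dm A) p)).
Proof. by rewrite pser_iter_Dm; apply: hom_iter_Dop. Qed.

Section Main.
Variables (R : realType) (n m : nat).
Variables (Xa Ya Za : 'M[R]_n) (Xg Yg Zg : 'M[R]_m).
Hypotheses (triad_a : sl2_triad Xa Ya Za) (triad_g : sl2_triad Xg Yg Zg).

Let X1 := Dm (block_mx Ya 0 0 (0 : 'M[R]_m)).
Let Y1 := Dm (block_mx Xa 0 0 (0 : 'M[R]_m)).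
Let Z1 := Dm (block_mx Za 0 0 (0 : 'M[R]_m)).
Let X2 := Dm (block_mx (0 : 'M[R]_n) 0 0 Yg).
Let Y2 := Dm (block_mx (0 : 'M[R]_n) 0 0 Xg).
Let Z2 := Dm (block_mx (0 : 'M[R]_n) 0 0 Zg).

Let triad1 := sl2_triad_block triad_a (sl2_triad0 R m).
Let triad2 := sl2_triad_block (sl2_triad0 R n) triad_g.

Lemma iter_Dm_block_l (A : 'M[R]_n) (B : 'M[R]_m) k p :
  iter k (Dm (block_mx A 0 0 B)) (inl_mpoly m p) = inl_mpoly m (iter k (Dm A) p).
Proof. by elim: k => // k IH; rewrite !iterS IH Dm_inl. Qed.

Lemma iter_Dm_block_r (A : 'M[R]_n) (B : 'M[R]_m) k p :
  iter k (Dm (block_mx A 0 0 B)) (inr_mpoly n p) = inr_mpoly n (iter k (Dm B) p).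
Proof. by elim: k => // k IH; rewrite !iterS IH Dm_inr. Qed.

Lemma Dm_block_l0 (B : 'M[R]_m) p : Dm (block_mx (0 : 'M[R]_n) 0 0 B) (inl_mpoly m p) = 0.
Proof. by rewrite Dm_inl Dm0l /inl_mpoly linear0. Qed.

Lemma Dm_block_r0 (A : 'M[R]_n) p : Dm (block_mx A 0 0 (0 : 'M[R]_m)) (inr_mpoly n p) = 0.
Proof. by rewrite Dm_inr Dm0l /inr_mpoly linear0. Qed.

Lemma X1X2 h : X1 (X2 h) = X2 (X1 h).
Proof.
apply/eqP; rewrite -subr_eq0 Dm_commutator !mulmx_diag_block !mulmx0 !mul0mx subrr.
by rewrite Dm0l.
Qed.

Lemma iterX1_X2 k h : iter k X1 (X2 h) = X2 (iter k X1 h).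
Proof. by elim: k => // k IH; rewrite !iterS IH X1X2. Qed.

(** On [h] the operator [X2] is [- X1], and the two commute. This is how a top vector for [X1] also
    becomes one for [X2]. *)
Lemma iterX2_sign k h : X1 h + X2 h = 0 -> iter k X2 h = (-1) ^+ k *: iter k X1 h.
Proof.
move=> /eqP; rewrite addrC addr_eq0 => /eqP X2h.
elim: k => [|k IH]; first by rewrite expr0 scale1r.
rewrite iterS IH; transitivity ((-1) ^+ k *: X2 (iter k X1 h)); first exact: linearZ_LR.
by rewrite -iterX1_X2 X2h -scaleN1r iter_linearZ -iterSr scalerA -exprSr.
Qed.

Variables (p q : nat) (ua : 'I_p -> {mpoly R[n]}) (wa : 'I_p -> int).
Variables (ub : 'I_q -> {mpoly R[m]}) (wb : 'I_q -> int).
Variables (Aa : expo p -> Prop) (Ag : expo q -> Prop) (da : 'I_p -> nat) (db : 'I_q -> nat).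
Let alpha i := pser (ua i).
Let beta i := pser (ub i).
Hypothesis hom_alpha : forall i, hom_ser (da i) (alpha i).
Hypothesis hom_beta : forall i, hom_ser (db i) (beta i).
Hypothesis inv_alpha : forall i, weight_inv Ya Za (alpha i) (wa i).
Hypothesis inv_beta : forall i, weight_inv Yg Zg (beta i) (wb i).
Hypothesis sp_alpha : standard_preferred_set Ya alpha Aa.
Hypothesis sp_beta : standard_preferred_set Yg beta Ag.

Let f (k : expo p) : {mpoly R[n + m]} := inl_mpoly m (\prod_i ua i ^+ k i).
Let g (l : expo q) : {mpoly R[n + m]} := inr_mpoly n (\prod_i ub i ^+ l i).

Lemma weight_inv_Dm n' (MX MZ : 'M[R]_n') r (u : 'I_r -> {mpoly R[n']}) w :
  (forall i, weight_inv MX MZ (pser (u i)) (w i)) -> forall k : expo r,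
  Dm MX (\prod_i u i ^+ k i) = 0 /\
  Dm MZ (\prod_i u i ^+ k i) = (wdot w k)%:~R *: \prod_i u i ^+ k i.
Proof.
move=> inv k; split; last first.
  apply: (derivation_eigen_exp (DmM MZ)) => i; apply: pser_inj => e.
  by rewrite pserZ pser_Dm (inv i).2.
(* Membership in the kernel is treated as the eigenvalue 0. *)
rewrite (derivation_eigen_exp (w := fun _ => 0) (DmM MX)).
  by rewrite /wdot big1 ?scale0r // => i _; rewrite mul0r.
move=> i; apply: pser_inj => e; rewrite pserZ pser_Dm mul0r; exact: (inv i).1.
Qed.

Lemma X1f k : X1 (f k) = 0.
Proof. by rewrite /X1 Dm_inl (weight_inv_Dm inv_alpha k).1 /inl_mpoly linear0. Qed.

Lemma Z1f k : Z1 (f k) = (wdot wa k)%:~R *: f k.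
Proof. by rewrite /Z1 Dm_inl (weight_inv_Dm inv_alpha k).2 /inl_mpoly linearZ. Qed.

Lemma X2g l : X2 (g l) = 0.
Proof. by rewrite /X2 Dm_inr (weight_inv_Dm inv_beta l).1 /inr_mpoly linear0. Qed.

Lemma Z2g l : Z2 (g l) = (wdot wb l)%:~R *: g l.
Proof. by rewrite /Z2 Dm_inr (weight_inv_Dm inv_beta l).2 /inr_mpoly linearZ. Qed.

Lemma fD (k k' : expo p) : f [ffun i => (k i + k' i)%N] = f k * f k'.
Proof.
rewrite /f -inl_mpolyM -big_split; congr inl_mpoly.
by apply: eq_bigr => i _; rewrite ffunE exprD.
Qed.

Lemma gD (l l' : expo q) : g [ffun i => (l i + l' i)%N] = g l * g l'.
Proof.
rewrite /g -inr_mpolyM -big_split; congr inr_mpoly.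
by apply: eq_bigr => i _; rewrite ffunE exprD.
Qed.

Lemma pser_fg k l : pser (f k * g l) = tensor (smon alpha k) (smon beta l).
Proof. by rewrite pser_tensor !pser_smon. Qed.

Definition leading (c : cel p q) (h : {mpoly R[n + m]}) : Prop :=
  [/\ X1 h + X2 h = 0, iter c.2.+1 X1 h = 0
    & exists2 k : R, k != 0 & iter c.2 X1 h = k *: (f c.1.1 * g c.1.2)].

Lemma leading1 : leading (czero p q) 1.
Proof.
split; first by rewrite /X1 /X2 !(derivation1 (DmM _)) addr0.
  by rewrite /X1 /= (derivation1 (DmM _)).
exists 1; rewrite ?oner_neq0 // scale1r /f /g.
rewrite !big1 ?inl_mpoly1 ?inr_mpoly1 ?mulr1 // => i _; by rewrite ffunE.
Qed.

(** Top orders add and top values multiply up to a positive factor, by [iter_derivation_top]; [fD]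
    and [gD] do the same for the exponents. *)
Lemma leadingM c c' h h' : leading c h -> leading c' h' -> leading (cadd c c') (h * h').
Proof.
case=> Xh top [k k0 E] [Xh' top' [k' k0' E']]; split.
- rewrite /X1 /X2 !DmM addrACA -mulrDl -mulrDr.
  by rewrite [_ + _ as X in X * _]Xh [_ + _ as X in _ * X]Xh' mul0r mulr0 addr0.
(* The orders [s+1] and [s'+1] combine to [(s+1) + (s'+1) - 1 = (s+s') + 1]. *)
- by have := iter_derivation_eq0 (DmM _) top top'; rewrite addSn addnS.
have [j j0 ->] := iter_derivation_top (DmM _) top top'.
exists (j%:R * (k * k')); first by rewrite !mulf_neq0 // pnatr_eq0 -lt0n.
rewrite E E' /= fD gD -scalerAl -scalerAr !scalerA mulrACA; congr (_ *: _); ring.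
Qed.

Definition theta (c : cel p q) : {mpoly R[n + m]} :=
  ptransv Y1 Y2 (f c.1.1) (g c.1.2) `|wdot wa c.1.1|%N `|wdot wb c.1.2|%N c.2.

Lemma pser_theta c : pser (theta c) = Tmap Xa Xg alpha wa beta wb c.
Proof.
apply/funext => e; rewrite /theta /ptransv /Tmap /transv pser_sum.
apply: eq_bigr => j _; rewrite pserZ /Y1 /Y2 iter_Dm_block_l iter_Dm_block_r.
by rewrite pser_tensor !pser_iter_Dm !pser_smon.
Qed.

Definition celdeg (c : cel p q) := (expo_deg da c.1.1 + expo_deg db c.1.2)%N.

Lemma hom_theta c : hom_ser (celdeg c) (pser (theta c)).
Proof.
move=> e ne; rewrite pser_theta /Tmap /transv big1 // => j _.
rewrite (@hom_tensor _ _ _ (expo_deg da c.1.1) (expo_deg db c.1.2)) ?mulr0 //.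
  exact/hom_iter_Dop/hom_smon.
exact/hom_iter_Dop/hom_smon.
Qed.

(** In the cone both weights are at least [s >= 0], so the absolute values in [Tmap] are the weights
    themselves. *)
Lemma cone_weights c : in_cone wa wb c ->
  [/\ (wdot wa c.1.1)%:~R = (`|wdot wa c.1.1|%N)%:R :> R, (c.2 <= `|wdot wa c.1.1|)%N,
      (wdot wb c.1.2)%:~R = (`|wdot wb c.1.2|%N)%:R :> R & (c.2 <= `|wdot wb c.1.2|)%N].
Proof.
case=> c1 c2; have g1 : 0 <= wdot wa c.1.1 by lia.
have g2 : 0 <= wdot wb c.1.2 by lia.
by split; rewrite ?pmulrn ?gez0_abs //; lia.
Qed.

Lemma theta_kernel c : in_cone wa wb c ->
  [/\ X1 (theta c) + X2 (theta c) = 0,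
      Z1 (theta c) + Z2 (theta c) =
        (wdot wa c.1.1 + wdot wb c.1.2 - (c.2.*2)%:Z)%:~R *: theta c & leading c (theta c)].
Proof.
move=> /cone_weights[Ea la Eb lb].
(* The iterates of [Y2] on [g] involve only the second group of variables, and those of [Y1] on [f]
   only the first; the other operators kill them. *)
have X1g j : X1 (iter j Y2 (g c.1.2)) = 0.
  by rewrite /Y2 iter_Dm_block_r; exact: Dm_block_r0.
have Z1g j : Z1 (iter j Y2 (g c.1.2)) = 0.
  by rewrite /Y2 iter_Dm_block_r; exact: Dm_block_r0.
have X2f j : X2 (iter j Y1 (f c.1.1)) = 0.
  by rewrite /Y1 iter_Dm_block_l; exact: Dm_block_l0.
have Z2f j : Z2 (iter j Y1 (f c.1.1)) = 0.
  by rewrite /Y1 iter_Dm_block_l; exact: Dm_block_l0.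
have Zf := Z1f c.1.1; have Zg' := Z2g c.1.2; rewrite Ea in Zf; rewrite Eb in Zg'.
have ker := ptransv_ker (DmM _) (DmM _) (Dm_XY triad1) (Dm_ZY triad1)
  (Dm_XY triad2) (Dm_ZY triad2) (X1f _) Zf (X2g _) Zg' X1g X2f la lb.
split=> //.
  rewrite rmorphB rmorphD /= Ea Eb.
  exact: (ptransv_weight (DmM _) (DmM _) (Dm_ZY triad1) (Dm_ZY triad2) Zf Zg' Z1g Z2f).
split=> //.
  exact: (iterS_ptransv (DmM _) (Dm_XY triad1) (Dm_ZY triad1) (X1f _) Zf X1g la).
exact: (ptransv_top (DmM _) (Dm_XY triad1) (Dm_ZY triad1) (X1f _) Zf X1g la).
Qed.

Lemma Z1fg k l : Z1 (f k * g l) = (wdot wa k)%:~R *: (f k * g l).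
Proof.
have Z1g : Z1 (g l) = 0 by exact: Dm_block_r0.
by rewrite [LHS]DmM -/Z1 Z1f Z1g mulr0 addr0 -scalerAl.
Qed.

Lemma Z2fg k l : Z2 (f k * g l) = (wdot wb l)%:~R *: (f k * g l).
Proof.
have Z2f : Z2 (f k) = 0 by exact: Dm_block_l0.
by rewrite [LHS]DmM -/Z2 Z2g Z2f mul0r add0r -scalerAr.
Qed.

(** Local nilpotency gives [N] with [Y^N h = 0], and [top_vector_relation] with independence yields
    [c k l * \prod_(j < N) (w - (r + j)) = 0]. A nonzero coefficient forces [w = r + j >= r]. This
    is done once for each triad. *)
Lemma kernel_weights_ge r h c (s : seq (expo p)) (t : expo p -> seq (expo q)) :
  uniq s -> (forall k, k \in s -> Aa k) -> (forall k, uniq (t k)) ->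
  (forall k l, l \in t k -> Ag l) -> X1 h + X2 h = 0 -> iter r.+1 X1 h = 0 ->
  iter r X1 h = \sum_(k <- s) \sum_(l <- t k) c k l *: (f k * g l) ->
  forall k l, k \in s -> l \in t k -> c k l != 0 -> in_cone wa wb (k, l, r).
Proof.
move=> us sA ut tB Xh top E.
have rel (w : expo p -> expo q -> int) (c' : expo p -> expo q -> R) N :
    \sum_(kl <- [seq (k, l) | k <- s, l <- t k])
      (c' kl.1 kl.2 * \prod_(j < N) ((w kl.1 kl.2)%:~R - (r + j)%:R)) *: (f kl.1 * g kl.2) = 0 ->
    forall k l, k \in s -> l \in t k -> c' k l != 0 -> r%:Z <= w k l.
  rewrite big_allpairs_dep /= => E' k l ks lt c0.
  have H := tensor_indep sp_alpha sp_beta us sA ut tB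
    (c := fun k l => c' k l * \prod_(j < N) ((w k l)%:~R - (r + j)%:R)) _ ks lt.
  have /eqP : c' k l * \prod_(j < N) ((w k l)%:~R - (r + j)%:R) = 0.
    apply: H => e; rewrite -[RHS](mcoeff0 _ (mnm_of_expo e)) -E' -/(pser _ _) pser_sum.
    apply: eq_bigr => k' _; rewrite pser_sum; apply: eq_bigr => l' _.
    by rewrite pserZ pser_fg.
  rewrite mulf_eq0 (negPf c0) /= prodf_seq_eq0 => /hasP[j _ /=].
  by rewrite subr_eq0 pmulrn eqr_int => /eqP ->; lia.
have Efl (c' : expo p -> expo q -> R) :
    \sum_(k <- s) \sum_(l <- t k) c' k l *: (f k * g l) =
    \sum_(kl <- [seq (k, l) | k <- s, l <- t k]) c' kl.1 kl.2 *: (f kl.1 * g kl.2).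
  by rewrite big_allpairs_dep.
move=> k l ks lt c0; split => /=.
  have [[N YN] _] := Dm_triad_nilpotent triad1 h.
  apply: (rel (fun k _ => wdot wa k) c N) ks lt c0.
  apply: (top_vector_relation (Dm_XY triad1) (Dm_ZX triad1) _ YN top); last by rewrite [LHS]E Efl.
  by move=> kl; apply: Z1fg.
have [[N YN] _] := Dm_triad_nilpotent triad2 h.
(* For the second triad the top vector is [X2^r h], which differs from [X1^r h] by this sign. *)
have c0' : (-1) ^+ r * c k l != 0 by rewrite mulf_neq0 ?signr_eq0.
apply: (rel (fun _ l => wdot wb l) (fun k l => (-1) ^+ r * c k l) N) ks lt c0'.
apply: (top_vector_relation (Dm_XY triad2) (Dm_ZX triad2) _ YN).
- by move=> kl; apply: Z2fg.
- by rewrite [LHS](iterX2_sign _ Xh) top scaler0.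
rewrite [LHS](iterX2_sign _ Xh) E -(Efl (fun k l => (-1) ^+ r * c k l)).
rewrite scaler_sumr; apply: eq_bigr => k' _; rewrite scaler_sumr.
by apply: eq_bigr => l' _; rewrite scalerA.
Qed.

(** * Monomials in the prime transvectants *)

Variables (t : nat) (pi : 'I_t -> cel p q).
Hypothesis piE : forall c, admissible_prime wa wb Aa Ag c <-> exists i, pi i = c.

Definition theta_mon (K : expo t) := \prod_i theta (pi i) ^+ K i.
Definition theta_deg (K : expo t) := (\sum_i celdeg (pi i) * K i)%N.

Lemma pi_cone i : in_cone wa wb (pi i).
Proof. by have [_ []] : admissible_prime wa wb Aa Ag (pi i) by apply/piE; exists i. Qed.

(** Degree 0 forces both exponents to vanish; then the weights are 0, the cone forces order 0, and
    the element is zero, hence no prime. So each degree has finitely many monomials. *)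
Lemma celdeg_pi_gt0 i : (0 < celdeg (pi i))%N.
Proof.
have [[_ nz _] [[w1 _] Ak Al]] : admissible_prime wa wb Aa Ag (pi i) by apply/piE; exists i.
rewrite lt0n; apply: contra_notN nz; rewrite addn_eq0 => /andP[/eqP k0 /eqP l0].
have k00 : (pi i).1.1 = [ffun=> 0%N].
  by apply/ffunP => j; rewrite ffunE; have := le_expo_deg sp_alpha hom_alpha j Ak; rewrite k0; case: (_ j).
have l00 : (pi i).1.2 = [ffun=> 0%N].
  by apply/ffunP => j; rewrite ffunE; have := le_expo_deg sp_beta hom_beta j Al; rewrite l0; case: (_ j).
move: w1 k00 l00; case: (pi i) => -[k l] s /= + k00 l00; rewrite k00 l00 => w1; congr (_, _, _).
move: w1; rewrite /wdot big1 => [|j _]; last by rewrite ffunE mulr0.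
by case: s.
Qed.

Lemma hom_theta_mon K : hom_ser (theta_deg K) (pser (theta_mon K)).
Proof. by rewrite pser_smon; apply: hom_smon => i; apply: hom_theta. Qed.

Lemma mem_box_theta K : K \in box t (theta_deg K).
Proof.
rewrite mem_box; apply/forallP => i; rewrite /theta_deg (bigD1 i) //=.
by rewrite (leq_trans _ (leq_addr _ _)) // leq_pmull // celdeg_pi_gt0.
Qed.

(** Multiply the transvectants of the primes in a decomposition of [c]: [K] counts how often each
    prime occurs, and [leadingM] adds up the leading data. *)
Lemma leading_exists c : admissible wa wb Aa Ag c ->
  exists2 K, theta_deg K = celdeg c & leading c (theta_mon K).
Proof.
case/(admissible_sum_primes sp_alpha.2 sp_beta.2) => s [sP ->] {c}.
elim: s sP => [|c s IH] sP /=.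
  exists [ffun=> 0%N].
    rewrite /theta_deg big1 => [|i _]; last by rewrite ffunE muln0.
    by rewrite /celdeg /expo_deg !big1 // => i _; rewrite ffunE muln0.
  by rewrite /theta_mon big1 => [|i _]; [exact: leading1 | rewrite ffunE].
have [|K degK leadK] := IH; first by move=> c' s'; apply: sP; rewrite inE s' orbT.
have [i pic] : exists i, pi i = c by apply/piE/sP; rewrite inE eqxx.
exists (incr i K).
  have -> : theta_deg (incr i K) = (celdeg c + theta_deg K)%N.
    rewrite /theta_deg; under eq_bigr do rewrite ffunE mulnDr.
    rewrite big_split /= addnC; congr (_ + _)%N; rewrite (bigD1 i) //= eqxx muln1 pic.
    by rewrite big1 ?addn0 // => j /negPf ->; rewrite muln0.
  rewrite degK /celdeg addnACA; congr (_ + _)%N; rewrite /expo_deg -big_split;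
    by apply: eq_bigr => j _; rewrite ffunE mulnDr.
have -> : theta_mon (incr i K) = theta c * theta_mon K.
  rewrite /theta_mon; under eq_bigr do rewrite ffunE exprD.
  rewrite big_split /= mulrC; congr (_ * _); rewrite (bigD1 i) //= eqxx expr1 pic.
  by rewrite big1 ?mulr1 // => j /negPf ->; rewrite expr0.
apply: leadingM leadK; rewrite -pic; by have [] := theta_kernel (pi_cone i).
Qed.

(** Fixing the degree keeps the sum finite, so it can be taken among polynomials. *)
Definition theta_span D (h : {mpoly R[n + m]}) := exists c : expo t -> R,
  h = \sum_(K <- box t D | theta_deg K == D) c K *: theta_mon K.

Lemma theta_spanD D h h' : theta_span D h -> theta_span D h' -> theta_span D (h + h').
Proof.
case=> c -> [c' ->]; exists (fun K => c K + c' K).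
by rewrite -big_split; apply: eq_bigr => K _; rewrite scalerDl.
Qed.

Lemma theta_spanZ D a h : theta_span D h -> theta_span D (a *: h).
Proof.
case=> c ->; exists (fun K => a * c K).
by rewrite scaler_sumr; apply: eq_bigr => K _; rewrite scalerA.
Qed.

Lemma theta_span_mon K : theta_span (theta_deg K) (theta_mon K).
Proof.
exists (fun L => (L == K)%:R).
rewrite big_mkcond (bigD1_seq K) ?box_uniq ?mem_box_theta //= !eqxx scale1r.
by rewrite big1 ?addr0 // => L /negPf ->; rewrite scale0r if_same.
Qed.

Lemma theta_span0 D : theta_span D 0.
Proof. by exists (fun _ => 0); rewrite big1 // => K _; rewrite scale0r. Qed.

Lemma hom_theta_span D h : theta_span D h -> hom_ser D (pser h).
Proof.
case=> c -> e ne; rewrite pser_sum big1 // => K /eqP degK.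
by rewrite pserZ hom_theta_mon ?mulr0 // degK.
Qed.

Lemma kernel_span r D h : hom_ser D (pser h) -> X1 h + X2 h = 0 -> iter r X1 h = 0 ->
  theta_span D h.
Proof.
elim: r h => [|r IH] h hD Xh top; first by rewrite [h]top; exact: theta_span0.
have FD : hom_ser D (pser (iter r X1 h)) by apply: hom_iter_Dm.
have X1F : X1 (iter r X1 h) = 0 by [].
(* [X2] commutes with [X1] and equals [- X1] on [h], so this is [- X1^(r+1) h]. *)
have X2F : X2 (iter r X1 h) = 0.
  rewrite -iterX1_X2; move/eqP: Xh; rewrite addrC addr_eq0 => /eqP ->.
  by rewrite -scaleN1r iter_linearZ -iterSr top scaler0.
have [||c cE] := hom_in_ker_tensor sp_alpha hom_alpha sp_beta hom_beta FD.
- by move=> e; rewrite -pser_Dm [Dm _ _]X1F /pser mcoeff0.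
- by move=> e; rewrite -pser_Dm [Dm _ _]X2F /pser mcoeff0.
pose s := klist_le Aa da D; pose u k := klist Ag db (D - expo_deg da k)%N.
have E : iter r X1 h = \sum_(k <- s) \sum_(l <- u k) c k l *: (f k * g l).
  apply: pser_inj => e; rewrite cE pser_sum; apply: eq_bigr => k _.
  by rewrite pser_sum; apply: eq_bigr => l _; rewrite pserZ pser_fg.
have sA k : k \in s -> Aa k by rewrite (mem_klist_le sp_alpha hom_alpha) => /andP[/asboolP].
have uA k l : l \in u k -> Ag l by rewrite (mem_klist sp_beta hom_beta) => /andP[/asboolP].
have cone := kernel_weights_ge (klist_le_uniq _ _ _) sA (fun k => klist_uniq _ _ _) uA Xh top E.
have term k l : k \in s -> l \in u k -> exists h',
    [/\ theta_span D h', X1 h' + X2 h' = 0 & iter r X1 h' = c k l *: (f k * g l)].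
  move=> ks lu; have [->|c0] := eqVneq (c k l) 0.
    exists 0; split; [exact: theta_span0 | by rewrite /X1 /X2 !linear0 addr0 |].
    by rewrite scale0r iter_linear0.
  have [|K degK [XK _ [a a0 EK]]] := @leading_exists (k, l, r).
    by split; [exact: cone | exact: sA | exact: uA lu].
  have -> : D = theta_deg K.
    move: ks lu; rewrite (mem_klist_le sp_alpha hom_alpha) (mem_klist sp_beta hom_beta).
    by rewrite degK /celdeg /= => /andP[_ le_kD] /andP[_ /eqP ->]; rewrite subnKC.
  exists ((c k l / a) *: theta_mon K); split.
  - exact/theta_spanZ/theta_span_mon.
  - by rewrite /X1 /X2 !linearZ_LR -scalerDr [X in _ *: X]XK scaler0.
  - by rewrite iter_linearZ [X in _ *: X]EK scalerA divfK.
(* Corrections for single terms add up; this is used for the inner sum over [l] and again for the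
   outer sum over [k]. *)
have sums (I : eqType) (v : seq I) (F : I -> {mpoly R[n + m]}) :
    (forall i, i \in v -> exists h',
      [/\ theta_span D h', X1 h' + X2 h' = 0 & iter r X1 h' = F i]) ->
    exists h', [/\ theta_span D h', X1 h' + X2 h' = 0 & iter r X1 h' = \sum_(i <- v) F i].
  elim: v => [|i v IHv] Fv.
    exists 0; split; [exact: theta_span0 | by rewrite /X1 /X2 !linear0 addr0 |].
    by rewrite big_nil iter_linear0.
  have [h1 [s1 K1 E1]] := Fv i (mem_head _ _).
  have [|h2 [s2 K2 E2]] := IHv; first by move=> j jv; apply: Fv; rewrite inE jv orbT.
  exists (h1 + h2); split; first exact: theta_spanD.
    by rewrite /X1 /X2 !linearD addrACA [X in X + _]K1 [X in _ + X]K2 addr0.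
  by rewrite big_cons iter_linearD [X in X + _]E1 [X in _ + X]E2.
have [|h' [h'span Xh' Eh']] := sums _ s (fun k => \sum_(l <- u k) c k l *: (f k * g l)).
  by move=> k ks; apply: sums => l lu; apply: term.
(* [h - h'] is again in the kernel and homogeneous of degree [D], and is now killed by [X1^r], so
   the induction hypothesis applies. *)
rewrite -(subrK h' h); apply: theta_spanD => //; rewrite -scaleN1r; apply: IH.
- move=> e ne; rewrite pserD pserZ hD // (hom_theta_span h'span) // mulr0 addr0 //.
- by rewrite /X1 /X2 !linearD !linearZ_LR addrACA -scalerDr [X in X + _]Xh [X in _ *: X]Xh' scaler0 addr0.
by rewrite iter_linearD iter_linearZ [X in _ *: X]Eh' [X in X + _]E scaleN1r subrr.
Qed.

End Main.

Theorem theorem11p7 (R : realType) (n m : nat)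
  (Xa Ya Za : 'M[R]_n) (Xg Yg Zg : 'M[R]_m)
  (p q : nat) (alpha : 'I_p -> ser R n) (wa : 'I_p -> int)
  (beta : 'I_q -> ser R m) (wb : 'I_q -> int)
  (Aa : expo p -> Prop) (Ag : expo q -> Prop)
  (t : nat) (pi : 'I_t -> cel p q) :
  sl2_triad Xa Ya Za -> sl2_triad Xg Yg Zg ->
  hilbert_basis_w Ya Za alpha wa -> hilbert_basis_w Yg Zg beta wb ->
  standard_preferred_set Ya alpha Aa -> standard_preferred_set Yg beta Ag ->
  injective pi ->
  (forall c, admissible_prime wa wb Aa Ag c <-> exists i, pi i = c) ->
  (forall c, admissible wa wb Aa Ag c ->
     exists s : seq (cel p q),
       (forall d, d \in s -> exists i, pi i = d) /\ c = foldr (@cadd p q) (czero p q) s) /\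
  hilbert_basis (block_mx Ya 0 0 Yg) (block_mx Za 0 0 Zg)
    (fun i => Tmap Xa Xg alpha wa beta wb (pi i)).
Proof.
move=> triad_a triad_g [inv_a _] [inv_b _] sp_a sp_b _ piE; split.
  move=> c /(admissible_sum_primes sp_a.2 sp_b.2)[s [sP E]].
  by exists s; split=> // d /sP /piE.
have /choice[da hom_a] i : exists d, hom_ser d (alpha i) by exact: (inv_a i).1.
have /choice[db hom_b] i : exists d, hom_ser d (beta i) by exact: (inv_b i).1.
have /choice[ua uaE] i := homog_pser (hom_a i).
have /choice[ub ubE] i := homog_pser (hom_b i).
(* The generators are homogeneous, so they may be replaced by polynomials. *)
have {uaE} ? : alpha = fun i => pser (ua i) by apply/funext => i.
have {ubE} ? : beta = fun i => pser (ub i) by apply/funext => i.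
subst alpha beta.
have wi_a i := (inv_a i).2; have wi_b i := (inv_b i).2.
have block_split (A : 'M[R]_n) (B : 'M[R]_m) h : Dm (block_mx A 0 0 B) h =
    Dm (block_mx A 0 0 (0 : 'M[R]_m)) h + Dm (block_mx (0 : 'M[R]_n) 0 0 B) h.
  by rewrite -DmDl add_block_mx !addr0 add0r.
have thetaE i := pser_theta Xa Xg ua wa ub wb (pi i).
have ker i := theta_kernel triad_a triad_g wi_a wi_b (pi_cone piE i).
exists (fun i => wdot wa (pi i).1.1 + wdot wb (pi i).1.2 - ((pi i).2.*2)%:Z); split=> [i|h kerh].
  rewrite -thetaE; split.
    by exists (celdeg da db (pi i)); apply: hom_theta.
  have [K1 K2 _] := ker i; split=> e; rewrite -pser_Dm block_split ?K1 ?K2 ?pserZ //.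
  by rewrite /pser mcoeff0.
have span D : exists c : expo t -> R, forall e, hom_part D h e =
    \sum_(K <- box t D | theta_deg da db pi K == D)
      c K * pser (theta_mon Xa Xg ua wa ub wb pi K) e.
  have [P PE] := homog_pser (@hom_hom_part _ _ D h).
  have XP : Dm (block_mx Ya 0 0 (0 : 'M[R]_m)) P + Dm (block_mx (0 : 'M[R]_n) 0 0 Yg) P = 0.
    rewrite -block_split; apply: pser_inj => e.
    by rewrite pser_Dm PE Dop_hom_part /hom_part kerh if_same /pser mcoeff0.
  (* Local nilpotency supplies the order [r] from which the induction in [kernel_span] starts. *)
  have [_ [r rP]] := Dm_triad_nilpotent (sl2_triad_block triad_a (sl2_triad0 R m)) P.
  have PD : hom_ser D (pser P) by rewrite PE; apply: hom_hom_part.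
  have [c cE] := kernel_span triad_a triad_g hom_a hom_b wi_a wi_b sp_a sp_b piE PD XP rP.
  by exists c => e; rewrite -PE cE pser_sum; apply: eq_bigr => K _; rewrite pserZ.
have /choice[c cE] := span.
have hom_mon K := @hom_theta_mon R n m Xa Xg p q ua wa ub wb da db hom_a hom_b t pi K.
have monE K : smon (fun i => Tmap Xa Xg (fun i => pser (ua i)) wa (fun i => pser (ub i)) wb (pi i)) K =
    pser (theta_mon Xa Xg ua wa ub wb pi K).
  by rewrite pser_smon; congr smon; apply/funext => i; rewrite thetaE.
(* A monomial occurs in a single degree, so its coefficient is read off from the homogeneous part of
   [h] of that degree. *)
exists (fun K => c (theta_deg da db pi K) K); split=> // e.
(* Only monomials of the degree of [e] contribute to the coefficient at [e], and [mem_box_theta]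
   shows that this finite list contains them all. *)
exists [seq K <- box t (Defs.mdeg e) | theta_deg da db pi K == Defs.mdeg e]; split.
- by rewrite filter_uniq ?box_uniq.
- move=> K; rewrite mem_filter negb_and monE => /orP[degK|].
    by rewrite hom_mon ?mulr0 // eq_sym.
  have [<-|degK] := eqVneq (theta_deg da db pi K) (Defs.mdeg e); last first.
    by rewrite hom_mon ?mulr0 // eq_sym.
  by rewrite (mem_box_theta hom_a hom_b sp_a sp_b piE).
have := cE (Defs.mdeg e) e; rewrite /hom_part eqxx => ->.
by rewrite big_filter; apply: eq_bigr => K /eqP ->; rewrite monE.
Qed.
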